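(* Let $G_m$ be a bounded Vilenkin group and $0<p<1/2$. Then there exists an absolute constant $c_p$, depending only on $p$ (the sequence $m$ being fixed), such that for every $f\in H_p(G_m)$ $$\sum_{n=2}^{\infty}\frac{\log^pn\,\|R_nf\|_{H_p}^p}{n^{2-2p}}\le c_p\|f\|_{H_p}^p ,$$ where $R_nf$ is the $n$-th Riesz logarithmic mean of the Vilenkin–Fourier series of $f$.
   Context: Let $m=(m_0,m_1,\ldots)$ be a fixed sequence of integers $m_k\ge 2$ with $\sup_k m_k<\infty$. $G_m=\prod_{k\ge0}Z_{m_k}$, $Z_{m_k}=\{0,\ldots,m_k-1\}$ the integers mod $m_k$, is the bounded Vilenkin group with product (of discrete) topology and normalized Haar measure $\mu$. $I_0(x)=G_m$, $I_n(x)=\{y\in G_m: y_0=x_0,\ldots,y_{n-1}=x_{n-1}\}$. $M_0=1$, $M_{k+1}=m_kM_k$; every $n\in\mathbb{N}$ is uniquely $n=\sum_j n_jM_j$ with $n_j\in Z_{m_j}$. $r_k(x)=\exp(2\pi i x_k/m_k)$ and $\psi_n=\prod_k r_k^{n_k}$ (Vilenkin system). $\mathbb{N}=\{0,1,2,\ldots\}$. For $f\in L_1(G_m)$: $\widehat f(n)=\int_{G_m} f\overline{\psi_n}\,d\mu$; $S_0f=0$, $S_nf=\sum_{k=0}^{n-1}\widehat f(k)\psi_k$. $\|g\|_p=(\int_{G_m}|g|^pd\mu)^{1/p}$. Let $\mathcal F_n$ be the $\sigma$-algebra generated by the sets $I_n(x)$, $x\in G_m$. A martingale is a sequence $f=(f^{(n)}:n\in\mathbb{N})$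 of integrable functions with $f^{(n)}$ $\mathcal F_n$-measurable and $S_{M_n}f^{(l)}=f^{(n)}$ for $n\le l$. $f^*=\sup_n|f^{(n)}|$; $H_p=H_p(G_m)$ ($0<p<\infty$) is the space of martingales with $\|f\|_{H_p}:=\|f^*\|_p<\infty$. For a martingale, $\widehat f(i)=\lim_{k\to\infty}\int_{G_m}f^{(k)}\overline{\psi_i}\,d\mu$ and $S_nf=\sum_{k=0}^{n-1}\widehat f(k)\psi_k$. An integrable function $g$ is identified with the martingale $(S_{M_n}g:n\in\mathbb{N})$, which defines $\|g\|_{H_p}$. Riesz logarithmic means: for $n\ge2$, $R_nf=\frac1{l_n}\sum_{k=1}^{n-1}\frac{S_kf}{k}$ with $l_n=\sum_{k=1}^{n-1}\frac1k$. *)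

(* Defs.v *)
From HB Require Import structures.
From mathcomp Require Import all_boot all_order all_algebra.
From mathcomp Require Import complex.
From mathcomp Require Import all_classical all_reals all_analysis.

Set Implicit Arguments.
Unset Strict Implicit.
Unset Printing Implicit Defensive.
Import Order.TTheory GRing.Theory Num.Theory.
Import numFieldNormedType.Exports.
Local Open Scope classical_set_scope.
Local Open Scope ring_scope.
Local Open Scope complex_scope.

(* 'Z_n is the ring of integers modulo n only when n >= 2; statements about
   [vilenkin m] must therefore assume [2 <= m k] for all k. *)
Definition vilenkin (m : nat -> nat) : Type := forall k : nat, 'Z_(m k).

Section vilenkin_instances.
Variable m : nat -> nat.
Implicit Types x y z : vilenkin m.

HB.instance Definition _ := gen_eqMixin (vilenkin m).
HB.instance Definition _ := gen_choiceMixin (vilenkin m).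

Definition vzero : vilenkin m := fun=> 0.
Definition vopp x : vilenkin m := fun k => - x k.
Definition vadd x y : vilenkin m := fun k => x k + y k.

Let vaddA : associative vadd.
Proof. by move=> x y z; apply/functional_extensionality_dep => k; exact: addrA. Qed.

Let vaddC : commutative vadd.
Proof. by move=> x y; apply/functional_extensionality_dep => k; exact: addrC. Qed.

Let vadd0 : left_id vzero vadd.
Proof. by move=> x; apply/functional_extensionality_dep => k; exact: add0r. Qed.

Let vaddN : left_inverse vzero vopp vadd.
Proof. by move=> x; apply/functional_extensionality_dep => k; exact: addNr. Qed.

HB.instance Definition _ :=
  GRing.isZmodule.Build (vilenkin m) vaddA vaddC vadd0 vaddN.

HB.instance Definition _ := isPointed.Build (vilenkin m) 0.

HB.instance Definition _ := Topological.copy (vilenkin m)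
  (prod_topology (fun k => discrete_topology 'Z_(m k))).

(* the Borel sigma-algebra *)
HB.instance Definition _ := Measurable.copy (vilenkin m)
  (g_sigma_algebraType (@open (vilenkin m))).

End vilenkin_instances.

(* Translation invariance; a translation-invariant Borel probability measure on
   the compact group [vilenkin m] is its normalized Haar measure. *)
Definition haar (R : realType) (m : nat -> nat)
    (mu : probability (vilenkin m) R) : Prop :=
  forall (a : vilenkin m) (A : set (vilenkin m)),
    measurable A -> mu [set a + x | x in A] = mu A.

Section vilenkin_system.
Variable m : nat -> nat.

Definition M (n : nat) : nat := (\prod_(j < n) m j)%N.

(* the digit n_k of n = \sum_j n_j M_j *)
Definition digit (n k : nat) : nat := ((n %/ M k) %% m k)%N.

Definition I_ (n : nat) (x : vilenkin m) : set (vilenkin m) :=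
  [set y | forall k, (k < n)%N -> y k = x k].

Definition rademacher (R : realType) (k : nat) (x : vilenkin m) : R[i] :=
  let t : R := 2 * pi * (nat_of_ord (x k))%:R / (m k)%:R in cos t +i* sin t.

(* The product over all k reduces to k < n: when m_j >= 2 for all j one has
   M_k >= 2 ^ k > n, hence n_k = 0, for every k >= n. *)
Definition psi (R : realType) (n : nat) (x : vilenkin m) : R[i] :=
  \prod_(k < n) rademacher R k x ^+ digit n k.

End vilenkin_system.

Section fourier.
Variables (R : realType) (m : nat -> nat) (mu : probability (vilenkin m) R).

Local Notation G := (vilenkin m).
Local Notation C := R[i].

Definition cmeasurable_fun d (T : measurableType d) (f : T -> C) : Prop :=
  measurable_fun [set: T] (fun x => complex.Re (f x)) /\
  measurable_fun [set: T] (fun x => complex.Im (f x)).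

Definition cintegrable (f : G -> C) : Prop :=
  mu.-integrable setT (fun x => (complex.Re (f x))%:E) /\
  mu.-integrable setT (fun x => (complex.Im (f x))%:E).

Definition cintegral (f : G -> C) : C :=
  (\int[mu]_x complex.Re (f x)) +i* (\int[mu]_x complex.Im (f x)).

(* Partial sums and Riesz logarithmic means of the series
   \sum_k a_k psi_k; they are used below both for integrable functions and for
   martingales, which differ only in how the coefficients are obtained. *)
Definition partial_sum (a : nat -> C) (n : nat) (x : G) : C :=
  \sum_(k < n) a k * psi R k x.

Definition riesz_log_mean (a : nat -> C) (n : nat) (x : G) : C :=
  (\sum_(1 <= k < n) (k%:R)^-1)^-1 *
  \sum_(1 <= k < n) partial_sum a k x / k%:R.

Definition fourier_coef (f : G -> C) (n : nat) : C :=
  cintegral (fun x => f x * (psi R n x)^*%C).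

Definition S_ (n : nat) (f : G -> C) : G -> C := partial_sum (fourier_coef f) n.

(* G equipped with the sigma-algebra F_n *)
Definition Fn (n : nat) : Type := g_sigma_algebraType (range (@I_ m n)).
HB.instance Definition _ n := Measurable.on (Fn n).

Definition martingale (f : nat -> G -> C) : Prop :=
  [/\ forall n, cintegrable (f n),
      forall n, cmeasurable_fun (f n : Fn n -> C) &
      forall n l, (n <= l)%N -> S_ (M m n) (f l) = f n].

Definition mfourier_coef (f : nat -> G -> C) (i : nat) : C :=
  lim ((fourier_coef (f k) i : (R[i] : numFieldType)) @[k --> \oo]).

Definition mriesz (n : nat) (f : nat -> G -> C) : G -> C :=
  riesz_log_mean (mfourier_coef f) n.

Definition martingale_of (g : G -> C) : nat -> G -> C := fun n => S_ (M m n) g.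

Definition maximal (f : nat -> G -> C) (x : G) : \bar R :=
  ereal_sup (range (fun n => (Normc.normc (f n x))%:E)).

Definition Hnorm (p : R) (f : nat -> G -> C) : \bar R :=
  'N[mu]_(p%:E)[maximal f].

Definition Hardy (p : R) (f : nat -> G -> C) : Prop :=
  martingale f /\ (Hnorm p f < +oo)%E.

End fourier.

(* Main.v *)
Require Import Defs.
From HB Require Import structures.
From mathcomp Require Import all_boot all_order all_algebra.
From mathcomp Require Import complex.
From mathcomp Require Import all_classical all_reals all_analysis.
From mathcomp Require Import measurable_realfun.
From mathcomp Require Import ring lra zify.

Import Order.TTheory GRing.Theory Num.Theory.
Import numFieldNormedType.Exports.
Local Open Scope classical_set_scope.
Local Open Scope ring_scope.

Set Implicit Arguments.
Unset Strict Implicit.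
Unset Printing Implicit Defensive.

(** Write [f_l] for the l-th term of the martingale, [T_n = \sum_(1 <= k < n) S_k f / k]
    and [r = 1 - 2 p > 0].  Since [ln n <= l_n], it suffices to bound
    [\sum_n n^(2p-2) ||T_n||_{H_p}^p], and no atomic decomposition is needed.
    - Fejer kernels: for [M_l <= k < M_(l+1)], the sum [D_1 + ... + D_k] is
      dominated by [\sum_(s <= l) M_s (M_s 1_{I_s}(x) + \sum_(t < s, c) M_t 1_{I_s}(x - c e_t))].
      Hence [|S_1 f + ... + S_k f|] is controlled by translates of the local
      means of [|f_(l+1)|] over the cosets of [I_s], [s <= l].
    - Local means: [|f_l|] is dominated by a nondecreasing adapted sequence
      [H_l <= 2 sup_n |f_n|] which at least doubles whenever it changes, so that the
      p-th powers of its increments sum up to at most [C H_l^p].  An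
      [F_i]-measurable [g >= 0] satisfies [(\int g)^p <= M_i^(1-p) \int g^p];
      applied to the increments, this bounds the local means with a geometric
      gain, and the sum over [s] converges because [r > 0].
    - Summation by parts, and [S_(M_j) T_n = T_(M_j) + f_j \sum_(M_j <= k < n) 1/k]
      when [M_j < n], pass from the Fejer sums to the maximal function of [T_n].
    The functions involved depend on finitely many coordinates, so that their
    integrals are finite averages. *)

(** * Characters *)

Section characters.
Context (R : realType) (m : nat -> nat) (m_ge2 : forall k, (2 <= m k)%N).
Local Notation G := (vilenkin m).
Local Notation C := R[i].
Implicit Types (x y : G).

Lemma M0 : M m 0 = 1%N.
Proof. by rewrite /M big_ord0. Qed.

Lemma MS n : M m n.+1 = (M m n * m n)%N.
Proof. by rewrite /M big_ord_recr. Qed.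

Lemma M_gt0 n : (0 < M m n)%N.
Proof. by rewrite /M prodn_gt0 // => i; exact: leq_trans (m_ge2 i). Qed.

Lemma leq_M2 n : (M m n * 2 <= M m n.+1)%N.
Proof. by rewrite MS leq_mul2l m_ge2 orbT. Qed.

Lemma M_mono k n : (k <= n)%N -> (M m k <= M m n)%N.
Proof.
move=> /subnK <-; elim: (n - k)%N => [//|d IH].
by rewrite addSn (leq_trans IH) // (leq_trans _ (leq_M2 _)) // muln2 -addnn leq_addr.
Qed.

Lemma ltn_M n : (n < M m n)%N.
Proof.
elim: n => [|n IH]; first by rewrite M0.
apply: leq_trans (leq_M2 n); rewrite muln2 -addnn.
by rewrite -addn1; apply: leq_add => //; exact: M_gt0.
Qed.

Lemma dvdn_M k n : (k <= n)%N -> (M m k %| M m n)%N.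
Proof.
move=> /subnK <-; elim: (n - k)%N => [//|d IH].
by rewrite addSn MS dvdn_mulr.
Qed.

Definition evec (k c : nat) : G := fun j => if j == k then c%:R else 0.

Lemma evecD k c d : evec k (c + d)%N = evec k c + evec k d.
Proof.
apply/functional_extensionality_dep => j.
by rewrite /evec /GRing.add /= /vadd; case: eqP => _; rewrite ?natrD ?addr0.
Qed.

Lemma evec0 k : evec k 0 = 0.
Proof. by apply/functional_extensionality_dep => j; rewrite /evec; case: eqP. Qed.

Lemma evec_m k : evec k (m k) = 0.
Proof.
apply/functional_extensionality_dep => j; rewrite /evec; case: eqP => // ->.
by rewrite pchar_Zp.
Qed.

Lemma vaddE x y k : (x + y) k = x k + y k. Proof. by []. Qed.
Lemma voppE x k : (- x) k = - x k. Proof. by []. Qed.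
Lemma v0E k : (0 : G) k = 0. Proof. by []. Qed.

Lemma digit_eq0 n k : (n < M m k)%N -> digit m n k = 0%N.
Proof. by move=> nk; rewrite /digit divn_small // mod0n. Qed.

Lemma digit_low c i s k : (k < s)%N ->
  digit m (c * M m s + i) k = digit m i k.
Proof.
move=> ks; rewrite /digit divnDl ?dvdn_mull ?dvdn_M 1?ltnW //.
rewrite -modnDml; suff -> : ((c * M m s) %/ M m k %% m k = 0)%N by rewrite add0n.
apply/eqP; rewrite -/(dvdn _ _).
have /dvdnP[q ->] := dvdn_M ks.
have -> : (c * (q * M m k.+1) = c * q * m k * M m k)%N.
  by rewrite MS (mulnC (M _ _)) !mulnA.
by rewrite mulnK ?M_gt0 // dvdn_mull.
Qed.

Lemma digit_top c i s : (i < M m s)%N -> (c < m s)%N ->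
  digit m (c * M m s + i) s = c.
Proof.
by move=> iM cm; rewrite /digit divnMDl ?M_gt0 // divn_small // addn0 modn_small.
Qed.

Local Notation rad := (@rademacher m R).
Local Notation psi := (@psi m R).

(** Digits at positions k >= K vanish when n < M_K, so the product may run over any such range;
    characters of different indices can then share one. *)
Lemma psiE K n x : (n < M m K)%N ->
  psi n x = \prod_(k < K) rad k x ^+ digit m n k.
Proof.
move=> nK; rewrite /Defs.psi.
have ext a b : (a <= b)%N -> (n < M m a)%N ->
    \prod_(k < a) rad k x ^+ digit m n k = \prod_(k < b) rad k x ^+ digit m n k.
  move=> /subnK <- na; elim: (b - a)%N => [//|d IH].
  by rewrite addSn big_ord_recr/= IH digit_eq0 ?expr0 ?mulr1 //
    (leq_trans na) // M_mono // leq_addl.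
have [nlK|/ltnW Kn] := leqP n K; first by apply: ext => //; exact: ltn_M.
by apply/esym/ext.
Qed.

(** Splits off the top digit c of the index; the lower digits are those of i because M_(k+1) divides
    M_s for k < s. The kernel recursions start from this. *)
Lemma psi_top c i s x : (i < M m s)%N -> (c < m s)%N ->
  psi (c * M m s + i) x = rad s x ^+ c * psi i x.
Proof.
move=> iM cm.
have lt : (c * M m s + i < M m s.+1)%N.
  rewrite MS (leq_trans (_ : _ < c.+1 * M m s)%N) //.
    by rewrite mulSn addnC ltn_add2r.
  by rewrite mulnC leq_mul2l cm orbT.
rewrite (psiE _ lt) (psiE _ iM) big_ord_recr/= digit_top // mulrC.
by congr (_ * _); apply: eq_bigr => k _; rewrite digit_low.
Qed.

Definition cis (t : R) : C := (cos t +i* sin t)%C.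

Lemma cisD s t : cis (s + t) = cis s * cis t.
Proof.
rewrite /cis cosD sinD; apply/eqP; rewrite eq_complex /=.
by apply/andP; split; apply/eqP => //=; ring.
Qed.

Lemma cis_normc t : Normc.normc (cis t) = 1.
Proof. by rewrite /cis /= cos2Dsin2 sqrtr1. Qed.

Lemma cis_2pin n : cis (2 * pi * n%:R) = 1.
Proof.
elim: n => [|n IH]; first by rewrite mulr0 /cis cos0 sin0.
have -> : 2 * pi * n.+1%:R = 2 * pi * n%:R + (pi + pi) :> R by rewrite -natr1; ring.
by rewrite cisD IH mul1r /cis cosD sinD cospi sinpi !(mulr0,mul0r,mulrN1,addr0,opprK,subr0).
Qed.

Definition angle k (n : nat) : R := 2 * pi * n%:R / (m k)%:R.

Lemma mR_neq0 k : ((m k)%:R : R) != 0.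
Proof. by rewrite pnatr_eq0 -lt0n (leq_trans _ (m_ge2 k)). Qed.

Lemma angle_mod k n : cis (angle k (n %% m k)) = cis (angle k n).
Proof.
have -> : angle k n = 2 * pi * (n %/ m k)%:R + angle k (n %% m k).
  rewrite /angle {1}(divn_eq n (m k)) (natrD _ (_ * _)%N) natrM.
  by have := mR_neq0 k => h; field.
by rewrite cisD cis_2pin mul1r.
Qed.

Lemma radE k x : rad k x = cis (angle k (x k)). Proof. by []. Qed.

Lemma Zp_m k : (Zp_trunc (m k)).+2 = m k.
Proof. by rewrite Zp_cast. Qed.

Lemma radD k x y : rad k (x + y) = rad k x * rad k y.
Proof.
rewrite !radE vaddE.
have -> : nat_of_ord (x k + y k) = ((x k + y k) %% m k)%N.
  by rewrite /= [X in (_ %% X)%N]Zp_m.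
rewrite angle_mod -cisD; congr cis.
by rewrite /angle (natrD _ (x k)) mulrDr mulrDl.
Qed.

Lemma rad0 k : rad k 0 = 1.
Proof. by rewrite radE v0E /angle /= mulr0 mul0r /cis cos0 sin0. Qed.

Lemma rad_normc k x : Normc.normc (rad k x) = 1.
Proof. by rewrite radE cis_normc. Qed.

Lemma normc_conjM (z : C) : Normc.normc z = 1 -> z * (z^*)%C = 1.
Proof.
case: z => a b /= h; have : Num.sqrt (a ^+ 2 + b ^+ 2) ^+ 2 = 1 by rewrite h expr1n.
rewrite sqr_sqrtr ?addr_ge0 ?sqr_ge0 // => e.
apply/eqP; rewrite eq_complex /=; apply/andP; split; apply/eqP; last by ring.
by rewrite -[RHS]e; ring.
Qed.

Lemma rad_low k x : x k = 0 -> rad k x = 1.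
Proof. by rewrite radE => ->; rewrite /angle mulr0 mul0r /cis cos0 sin0. Qed.

(** With s = t / 2, the equality cos^2 s - sin^2 s = 1 forces sin s = 0, which is impossible for 0 <
    s < pi. *)
Lemma cis_neq1 (t : R) : 0 < t < 2 * pi -> cis t != 1.
Proof.
move=> /andP[t0 t2]; apply/eqP => -[+ _].
have -> : t = t / 2 + t / 2 by field.
have /lt0r_neq0 s0 : 0 < sin (t / 2) by apply: sin_gt0_pi; rewrite ?in_itv/=; lra.
rewrite cosD => h.
have := cos2Dsin2 (t / 2); rewrite !expr2 => h2.
have : sin (t / 2) * sin (t / 2) = 0 by lra.
by move/eqP; rewrite mulf_eq0 orbb (negbTE s0).
Qed.

Lemma rad_neq1 k x : x k != 0 -> rad k x != 1.
Proof.
move=> xk; rewrite radE; apply: cis_neq1.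
have m0 : 0 < (m k)%:R :> R by rewrite ltr0n (leq_trans _ (m_ge2 k)).
have p0 := @pi_gt0 R.
have x0 : (0 < x k)%N by rewrite lt0n; apply: contra xk => /eqP e; apply/eqP/val_inj.
have xm : (x k < m k)%N by have := ltn_ord (x k); rewrite [X in (_ < X)%N -> _]Zp_m.
rewrite /angle; apply/andP; split.
  by rewrite divr_gt0 // !mulr_gt0 // ltr0n.
by rewrite ltr_pdivrMr // ltr_pM2l ?mulr_gt0 // ltr_nat.
Qed.

Lemma evecM k c d : evec k (c * d) = evec k c *+ d.
Proof.
elim: d => [|d IH]; first by rewrite muln0 evec0 mulr0n.
by rewrite mulnS addnC evecD IH mulrSr.
Qed.

Lemma rad_exp k x n : rad k (x *+ n) = rad k x ^+ n.
Proof.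
by elim: n => [|n IH]; rewrite ?mulr0n ?rad0 ?expr0 // mulrSr radD IH exprSr.
Qed.

Lemma rad_unity k x : rad k x ^+ m k = 1.
Proof.
rewrite -rad_exp; apply: rad_low.
have -> n : (x *+ n) k = x k *+ n.
  by elim: n => [//|n IH]; rewrite !mulrSr vaddE IH.
by rewrite -mulr_natr pchar_Zp ?mulr0.
Qed.

Lemma evec_out k j c : j != k -> evec k c j = 0.
Proof. by rewrite /evec => /negbTE ->. Qed.

Lemma evec_in k c : evec k c k = c%:R.
Proof. by rewrite /evec eqxx. Qed.

Lemma Zp_nat_neq0 k c : (0 < c < m k)%N -> (c%:R : 'Z_(m k)) != 0.
Proof.
move=> /andP[c0 cm]; apply/eqP => /(congr1 val); rewrite /= val_Zp_nat //.
by rewrite modn_small // => ce; rewrite ce in c0.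
Qed.

(** r_k(e_k) is a primitive m_k-th root of unity: the ratio of the two powers is r_k at (b - a) e_k,
    whose k-th coordinate is nonzero when a < b < m_k. *)
Lemma rad_evec_inj k a b : (a < m k)%N -> (b < m k)%N ->
  rad k (evec k 1) ^+ a = rad k (evec k 1) ^+ b -> a = b.
Proof.
wlog: a b / (a <= b)%N => [H|ab] am bm e.
  by have [ab|/ltnW ba] := leqP a b; [exact: H | apply/esym/H].
apply/eqP; rewrite eqn_leq ab /= leqNgt; apply/negP => ab'.
have /eqP := e; rewrite -(subnK ab) exprD -{1}[_ ^+ a]mul1r => /eqP /mulIf h.
have : rad k (evec k (b - a)) != 1.
  apply: rad_neq1; rewrite evec_in Zp_nat_neq0 // subn_gt0 ab' /=.
  by rewrite (leq_ltn_trans _ bm) // leq_subr.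
rewrite -{1}[(b - a)%N]mul1n evecM rad_exp -h ?eqxx //.
rewrite expf_neq0 //; apply/eqP => r0; have := rad_normc k (evec k 1).
by rewrite r0 Normc.normc0 => /esym/eqP; rewrite oner_eq0.
Qed.

Lemma psiD n x y : psi n (x + y) = psi n x * psi n y.
Proof.
by rewrite /Defs.psi -big_split; apply: eq_bigr => k _; rewrite radD exprMn.
Qed.

Lemma psi0 n : psi n 0 = 1.
Proof. by rewrite /Defs.psi big1 // => k _; rewrite rad0 expr1n. Qed.

Lemma psi_normc n x : Normc.normc (psi n x) = 1.
Proof.
rewrite /Defs.psi; elim/big_ind : _ => [|a b ha hb|k _]; first exact: Normc.normc1.
  by rewrite Normc.normcM ha hb mulr1.
elim: (digit _ _ _) => [|d IH]; first by rewrite expr0 Normc.normc1.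
by rewrite exprS Normc.normcM IH rad_normc mulr1.
Qed.

Lemma psiN n x : psi n (- x) = ((psi n x)^*)%C.
Proof.
have h : psi n x * psi n (- x) = 1 by rewrite -psiD subrr psi0.
have h2 := normc_conjM (psi_normc n x).
by rewrite -[LHS]mulr1 -h2 mulrA (mulrC (psi n (- x))) h mul1r.
Qed.

(** For complex-valued g this is F_n-measurability, the atoms of F_n being the finitely many cosets
    I_n(x). *)
Definition cyl (T : Type) (n : nat) (g : G -> T) :=
  forall x y, (forall k, (k < n)%N -> x k = y k) -> g x = g y.

Lemma psi_cyl L n : (n < M m L)%N -> cyl L (psi n).
Proof.
move=> nL x y xy; rewrite !(psiE _ nL).
by apply: eq_bigr => k _; rewrite !radE xy.
Qed.

Lemma ltn_split n s : (n < M m s.+1)%N ->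
  exists c i, [/\ (c < m s)%N, (i < M m s)%N & n = (c * M m s + i)%N].
Proof.
move=> nM; exists (n %/ M m s)%N, (n %% M m s)%N; split.
- by rewrite ltn_divLR ?M_gt0 // mulnC -MS.
- by rewrite ltn_mod M_gt0.
- exact: divn_eq.
Qed.

Lemma psi_evec_low n L k c : (n < M m L)%N -> (L <= k)%N -> psi n (evec k c) = 1.
Proof.
move=> nL Lk; rewrite -(psi0 n); apply: (psi_cyl nL) => j jL.
by rewrite evec_out // neq_ltn (leq_trans jL Lk).
Qed.

(** Compare top digits: if they differ, the last coordinate vector separates, since the lower
    characters equal 1 there; otherwise recurse on the remainders. *)
Lemma psi_separate L i j : (i < M m L)%N -> (j < M m L)%N -> i != j ->
  exists2 k, (k < L)%N & psi i (evec k 1) != psi j (evec k 1).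
Proof.
elim: L i j => [|L IH] i j; first by rewrite M0; case: i j => [|?] [|?].
move=> /ltn_split[c [i' [cm iM ->]]] /ltn_split[d [j' [dm jM ->]]].
have [<-|cd _] := eqVneq c d.
  rewrite eqn_add2l => ij; have [k kL h] := IH _ _ iM jM ij.
  exists k; first exact: ltnW.
  rewrite !psi_top // (_ : rad L _ = 1) ?expr1n ?mul1r //.
  by rewrite rad_low // evec_out // neq_ltn kL orbT.
exists L => //; rewrite !psi_top // !(@psi_evec_low _ L) // !mulr1.
by apply: contra cd => /eqP /rad_evec_inj ->.
Qed.

End characters.

(** * Dirichlet and Fejer kernels *)

Section kernels.
Context (R : realType) (m : nat -> nat) (m_ge2 : forall k, (2 <= m k)%N).
Local Notation G := (vilenkin m).
Local Notation C := R[i].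
Local Notation rad := (@rademacher m R).
Local Notation psi := (@psi m R).
Local Notation nrm := (@Normc.normc R).
Implicit Types (x y : G).

Lemma normc_sum (I : Type) (r : seq I) (P : pred I) (F : I -> C) :
  nrm (\sum_(i <- r | P i) F i) <= \sum_(i <- r | P i) nrm (F i).
Proof.
elim/big_ind2 : _ => [|a b c d ab cd|//]; first by rewrite Normc.normc0.
by apply: le_trans (lerD ab cd); exact: le_normcD.
Qed.

Lemma normc_ge0 (z : C) : 0 <= nrm z.
Proof. by case: z => a b; rewrite /= sqrtr_ge0. Qed.

Lemma normc_nat n : nrm n%:R = n%:R.
Proof. by rewrite -[n%:R]/(1 *+ n) normcMn Normc.normc1. Qed.

Lemma normcX (z : C) n : nrm (z ^+ n) = nrm z ^+ n.
Proof.
by elim: n => [|n IH]; rewrite ?expr0 ?Normc.normc1 // !exprS Normc.normcM IH.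
Qed.

Definition box (s : nat) (x : G) : bool := [forall k : 'I_s, x k == 0].

Lemma boxP s x : reflect (forall k, (k < s)%N -> x k = 0) (box s x).
Proof.
apply: (iffP forallP) => [h k ks|h k]; first exact/eqP/(h (Ordinal ks)).
by apply/eqP/h.
Qed.

Lemma boxS s x : box s.+1 x = box s x && (x s == 0).
Proof.
apply/boxP/andP => [h|[/boxP h /eqP h'] k].
  by split; [apply/boxP => k ks; apply: h; exact: ltnW | apply/eqP/h].
by rewrite ltnS leq_eqVlt => /orP[/eqP ->|/h].
Qed.

Lemma box_cyl s : cyl s (box s).
Proof. by move=> x y xy; apply/eq_forallb => k; rewrite xy. Qed.

Definition dirichlet n x : C := \sum_(i < n) psi i x.

(** The unnormalised Fejer kernel D_1 + ... + D_n; the shift skips D_0 = 0. *)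
Definition fejer_sum n x : C := \sum_(j < n) dirichlet j.+1 x.

Local Notation D := dirichlet.
Local Notation Q := fejer_sum.
Local Notation M := (M m).

Lemma dirichlet_split c s j x : (c < m s)%N -> (j <= M s)%N ->
  D (c * M s + j) x = D (c * M s) x + rad s x ^+ c * D j x.
Proof.
move=> cm jM; rewrite /D big_split_ord/= mulr_sumr; congr (_ + _).
by apply: eq_bigr => i _; rewrite psi_top // (leq_trans (ltn_ord i)).
Qed.

Lemma dirichlet_mul c s x : (c <= m s)%N ->
  D (c * M s) x = (\sum_(i < c) rad s x ^+ i) * D (M s) x.
Proof.
elim: c => [|c IH] cm; first by rewrite mul0n /D !big_ord0 mul0r.
by rewrite mulSn addnC dirichlet_split // IH 1?ltnW // big_ord_recr/= mulrDl.
Qed.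

(** r_s(x) is an m_s-th root of unity, so the geometric sum vanishes unless r_s(x) = 1, that is x_s
    = 0. *)
Lemma rad_sum s x : \sum_(i < m s) rad s x ^+ i = (m s)%:R * (x s == 0)%:R.
Proof.
case: eqP => [x0|/eqP x0].
  rewrite mulr1 (eq_bigr (fun=> 1)) => [|i _]; last by rewrite rad_low // expr1n.
  by rewrite sumr_const card_ord.
rewrite mulr0; apply/eqP; have := rad_neq1 R m_ge2 x0.
rewrite -subr_eq0 => r1; rewrite -(mulrI_eq0 _ (mulfI r1)) -subrX1.
by rewrite rad_unity // subrr.
Qed.

Lemma dirichlet_M s x : D (M s) x = (M s)%:R * (box s x)%:R.
Proof.
elim: s => [|s IH].
  rewrite M0 /D big_ord1 /Defs.psi big_ord0 mul1r.
  by rewrite (_ : box 0 x) //; apply/boxP.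
rewrite MS mulnC dirichlet_mul // rad_sum IH boxS natrM.
by case: (box s x); case: (x s == 0); rewrite /= ?mulr0 ?mul0r ?mulr1.
Qed.

(** Each of the last j Dirichlet kernels consists of the full [D (c * M s)] and r_s^c times a kernel
    of index at most j. *)
Lemma fejer_sum_split c s j x : (c < m s)%N -> (j <= M s)%N ->
  Q (c * M s + j) x = Q (c * M s) x + (j%:R * D (c * M s) x + rad s x ^+ c * Q j x).
Proof.
move=> cm jM; rewrite /Q big_split_ord/=; congr (_ + _).
rewrite mulr_natl -[X in _ *+ X]card_ord -sumr_const mulr_sumr -big_split/=.
apply: eq_bigr => i _; rewrite -addnS dirichlet_split //.
by rewrite (leq_trans (ltn_ord i)).
Qed.

Lemma fejer_sum_mul c s x : (c <= m s)%N ->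
  Q (c * M s) x = \sum_(i < c) ((M s)%:R * D (i * M s) x)
     + (\sum_(i < c) rad s x ^+ i) * Q (M s) x.
Proof.
elim: c => [|c IH] cm; first by rewrite mul0n /Q !big_ord0 mul0r addr0.
rewrite mulSn addnC fejer_sum_split // IH 1?ltnW // !big_ord_recr/= mulrDl.
by ring.
Qed.

Variable B : nat.
Hypothesis mB : forall k, (m k <= B)%N.

Lemma norm_rad_sum s c x : nrm (\sum_(i < c) rad s x ^+ i) <= c%:R.
Proof.
apply: le_trans (normc_sum _ _ _) _.
under eq_bigr do rewrite normcX rad_normc expr1n.
by rewrite sumr_const card_ord.
Qed.

Lemma norm_dirichlet_mul s c x : (c <= m s)%N ->
  nrm (D (c * M s) x) <= B%:R * (M s)%:R * (box s x)%:R.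
Proof.
move=> cm; rewrite dirichlet_mul // dirichlet_M Normc.normcM -natrM normc_nat.
rewrite natrM -mulrA ler_wpM2r // ?mulr_ge0 //.
by rewrite (le_trans (norm_rad_sum _ _ _)) // ler_nat (leq_trans cm).
Qed.

(** Majorant of |Q_(M_s)| up to the factor B^2. The term of index t carries what the recursion
    produces when coordinate t is added. *)
Definition kerP s x : R := (M s)%:R * ((M s)%:R * (box s x)%:R +
  \sum_(t < s) (M t)%:R * \sum_(c < m t) (box s (x - evec m t c))%:R).

Lemma box_kerP s x : (M s)%:R * ((M s)%:R * (box s x)%:R) <= kerP s x.
Proof.
rewrite ler_wpM2l // lerDl sumr_ge0 // => t _.
by rewrite mulr_ge0 // sumr_ge0.
Qed.

Lemma sum_dirichlet_mul c s x : (c <= m s)%N ->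
  nrm (\sum_(i < c) ((M s)%:R * D (i * M s) x)) <=
    B%:R ^+ 2 * ((M s)%:R * ((M s)%:R * (box s x)%:R)).
Proof.
move=> cm; apply: le_trans (normc_sum _ _ _) _.
apply: (@le_trans _ _ (\sum_(i < c) B%:R * ((M s)%:R * ((M s)%:R * (box s x)%:R)))).
  apply: ler_sum => i _; rewrite Normc.normcM normc_nat mulrCA ler_wpM2l //.
  rewrite mulrA norm_dirichlet_mul //.
  by rewrite (leq_trans _ cm) // ltnW.
rewrite sumr_const card_ord -[leLHS]mulr_natl mulrA expr2 ler_wpM2r ?mulr_ge0 //.
by rewrite ler_wpM2r // ler_nat (leq_trans cm).
Qed.

Lemma B_ge1 : 1 <= B%:R :> R.
Proof. by rewrite ler1n (leq_trans _ (mB 0)) // (leq_trans _ (m_ge2 0)). Qed.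

(** The factor m_s 1_(x_s = 0) turns M_s into M_(s+1) and shrinks every I_s to I_(s+1), which yields
    the terms t < s of the next majorant. The remaining peak on I_s fits into its new term t = s. *)
Lemma kerP_step s x :
  (M s)%:R * ((M s)%:R * (box s x)%:R) + (m s)%:R * (x s == 0)%:R * kerP s x
   <= kerP s.+1 x.
Proof.
have e1 : (m s)%:R * (x s == 0)%:R * kerP s x = (M s.+1)%:R * ((M s)%:R * (box s.+1 x)%:R +
    \sum_(t < s) (M t)%:R * \sum_(c < m t) (box s.+1 (x - evec m t c))%:R).
  have key (a b c X Y : R) : b * X = Y -> a * b * (c * X) = c * a * Y.
    by move=> <-; ring.
  rewrite MS natrM /kerP; apply: key; rewrite mulrDr boxS; congr (_ + _).
    by rewrite mulrCA; congr (_ * _); rewrite -natrM mulnb andbC.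
  rewrite mulr_sumr; apply: eq_bigr => t _; rewrite mulrCA; congr (_ * _).
  rewrite mulr_sumr; apply: eq_bigr => c _; rewrite boxS.
  rewrite vaddE voppE evec_out ?subr0 1?neq_ltn ?ltn_ord ?orbT //.
  by rewrite -natrM mulnb andbC.
rewrite e1 {e1} /kerP big_ord_recr/=.
set S := \sum_(t < s) _.
have MM : (M s)%:R <= (M s.+1)%:R :> R by rewrite ler_nat M_mono.
(* I_s is the union of the translates I_(s+1) + c e_s, and the one containing x has c = x_s. *)
have b : (box s x)%:R <= \sum_(c < m s) (box s.+1 (x - evec m s c))%:R :> R.
  case bx : (box s x); last by rewrite sumr_ge0.
  have xm : (x s < m s)%N.
    by have := ltn_ord (x s); rewrite [X in (_ < X)%N -> _]Zp_m.
  rewrite (bigD1 (Ordinal xm)) //= (_ : box s.+1 _) ?lerDl ?sumr_ge0 //.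
  rewrite boxS vaddE voppE evec_in natr_Zp subrr eqxx andbT.
  apply/boxP => k ks; rewrite vaddE voppE evec_out ?subr0 ?neq_ltn ?ks //.
  by move/boxP: bx; apply.
have h1 : (M s)%:R * ((M s)%:R * (box s x)%:R) <= (M s.+1)%:R * ((M s)%:R * \sum_(c < m s) (box s.+1 (x - evec m s c))%:R) :> R.
  by rewrite ler_pM ?mulr_ge0 // ler_wpM2l.
have h2 : (M s.+1)%:R * ((M s)%:R * (box s.+1 x)%:R) <= (M s.+1)%:R * ((M s.+1)%:R * (box s.+1 x)%:R) :> R.
  by rewrite ler_wpM2l // ler_wpM2r.
by rewrite !mulrDr; lra.
Qed.

(** The constant does not grow with s: the recursion multiplies the bound by the geometric sum and
    adds B^2 times a peak on I_s, and [kerP_step] absorbs both. *)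
Lemma norm_fejer_sum_M s x : nrm (Q (M s) x) <= B%:R ^+ 2 * kerP s x.
Proof.
have B1 := B_ge1.
elim: s => [|s IH].
  rewrite {1}M0 /Q big_ord1 /D big_ord1 psi_normc.
  have : 1 <= kerP 0 x.
    by rewrite /kerP M0 big_ord0 (_ : box 0 x) ?mul1r ?addr0 //; apply/boxP.
  have : 1 <= B%:R ^+ 2 :> R by rewrite exprn_ege1.
  by move=> b1 b2; rewrite -[leLHS]mulr1 ler_pM.
rewrite {1}MS mulnC fejer_sum_mul // rad_sum.
apply: le_trans (le_normcD _ _) _.
apply: le_trans (lerD (sum_dirichlet_mul _ _) (lexx _)) _ => //.
rewrite Normc.normcM Normc.normcM !normc_nat.
apply: le_trans (ler_wpM2l _ (kerP_step s x)); last by rewrite exprn_ge0.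
by rewrite mulrDr lerD2l [leRHS]mulrCA; apply: ler_wpM2l.
Qed.

Lemma norm_fejer_sum_mul c s x : (c <= m s)%N ->
  nrm (Q (c * M s) x) <= (B%:R ^+ 2 + B%:R ^+ 3) * kerP s x.
Proof.
move=> cm; rewrite fejer_sum_mul //.
apply: le_trans (le_normcD _ _) _.
apply: le_trans (lerD (sum_dirichlet_mul _ _) (lexx _)) _ => //.
rewrite mulrDl; apply: lerD; first by rewrite ler_wpM2l ?exprn_ge0 // box_kerP.
rewrite Normc.normcM exprS -mulrA; apply: ler_pM; rewrite ?normc_ge0 //.
  by rewrite (le_trans (norm_rad_sum _ _ _)) // ler_nat (leq_trans cm).
exact: norm_fejer_sum_M.
Qed.

Definition kerC : R := B%:R + B%:R ^+ 2 + B%:R ^+ 3.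

Lemma kerC_ge0 : 0 <= kerC.
Proof. by rewrite !addr_ge0. Qed.

(** Peel off the top digit of k: the full blocks and the Dirichlet term cost a multiple of the last
    [kerP], and the remainder is handled by induction. *)
Lemma norm_fejer_sum l k x : (k < M l)%N ->
  nrm (Q k x) <= kerC * \sum_(s < l) kerP s x.
Proof.
elim: l k => [|l IH] k.
  by rewrite M0; case: k => // _; rewrite /Q big_ord0 Normc.normc0 big_ord0 mulr0.
move=> /(ltn_split m_ge2)[c [j [cm jM ->]]].
rewrite fejer_sum_split //; last exact: ltnW.
rewrite big_ord_recr/= mulrDr.
apply: le_trans (le_normcD _ _) _.
apply: le_trans (lerD (norm_fejer_sum_mul _ (ltnW cm)) (le_normcD _ _)) _.
rewrite !Normc.normcM normcX rad_normc expr1n mul1r normc_nat.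
have h := IH _ jM.
have h2 : j%:R * nrm (D (c * M l) x) <= B%:R * kerP l x.
  apply: le_trans (_ : (M l)%:R * (B%:R * (M l)%:R * (box l x)%:R) <= _).
    by rewrite ler_pM ?normc_ge0 ?norm_dirichlet_mul // 1?ltnW // ler_nat ltnW.
  by rewrite -mulrA mulrCA ler_wpM2l // box_kerP.
rewrite /kerC !mulrDl in h *; lra.
Qed.

End kernels.

(** * Averages over finitely many coordinates *)

Section averages.
Context (R : realType) (m : nat -> nat) (m_ge2 : forall k, (2 <= m k)%N).
Local Notation G := (vilenkin m).
Local Notation C := R[i].
Local Notation psi := (@psi m R).
Local Notation nrm := (@Normc.normc R).
Local Notation M := (M m).
Local Notation ev := (evec m).
Implicit Types (x y u : G).

(* The integral over the first [L] coordinates, the others being set to 0. *)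
Fixpoint avg (K : fieldType) (L : nat) (g : G -> K) : K :=
  if L is L'.+1
  then avg L' (fun x => (m L')%:R^-1 * \sum_(c < m L') g (x + ev L' c))
  else g 0.

Lemma eq_avg (K : fieldType) L (f g : G -> K) : f =1 g -> avg L f = avg L g.
Proof. by move=> /funext ->. Qed.

Lemma avgZ (K : fieldType) L (a : K) g : avg L (fun x => a * g x) = a * avg L g.
Proof.
elim: L g => [//|L IH] g /=; rewrite -IH; apply: eq_avg => x.
by rewrite -mulr_sumr mulrCA.
Qed.

Lemma avgD (K : fieldType) L (f g : G -> K) :
  avg L (fun x => f x + g x) = avg L f + avg L g.
Proof.
elim: L f g => [//|L IH] f g /=; rewrite -IH; apply: eq_avg => x.
by rewrite big_split mulrDr.
Qed.

Lemma avg0 (K : fieldType) L : avg L (fun=> 0 : K) = 0.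
Proof.
by elim: L => [//|L IH] /=; rewrite -[RHS]IH; apply: eq_avg => x; rewrite big1 ?mulr0.
Qed.

Lemma avg_sum (K : fieldType) L (I : Type) (r : seq I) (P : pred I) (F : I -> G -> K) :
  avg L (fun x => \sum_(i <- r | P i) F i x) = \sum_(i <- r | P i) avg L (F i).
Proof.
elim: r => [|i r IH]; first by rewrite big_nil -[RHS](avg0 K L); apply: eq_avg => x; rewrite big_nil.
rewrite big_cons -IH; case: ifPn => Pi; last by apply: eq_avg => x; rewrite big_cons (negbTE Pi).
by rewrite -avgD; apply: eq_avg => x; rewrite big_cons Pi.
Qed.

Lemma avg_swap (K : fieldType) L N (F : G -> G -> K) :
  avg L (fun x => avg N (F x)) = avg N (fun u => avg L (F^~ u)).
Proof.
elim: N F => [//|N IH] F /=; rewrite IH; apply: eq_avg => u.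
by rewrite avgZ avg_sum.
Qed.

(** Adding e_k once permutes the residues mod m_k cyclically, the term c = m_k - 1 wrapping around
    to c = 0. *)
Lemma sum_evec_shift (K : fieldType) (g : G -> K) k x d :
  \sum_(c < m k) g (x + ev k c + ev k d) = \sum_(c < m k) g (x + ev k c).
Proof.
elim: d => [|d IH]; first by apply: eq_bigr => c _; rewrite evec0 // addr0.
rewrite -IH; have [n mE] : exists n, m k = n.+1.
  by exists (m k).-1; rewrite prednK // (leq_trans _ (m_ge2 k)).
have em : ev k n.+1 = 0 by rewrite -mE evec_m.
rewrite mE big_ord_recr [RHS]big_ord_recl [LHS]addrC /=; congr (_ + _).
  rewrite -!addrA -!evecD.
  by rewrite addnS -addSn [in LHS]evecD em add0r.
apply: eq_bigr => c _; rewrite /bump /= -!addrA -!evecD.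
by congr (g (_ + ev k _)); lia.
Qed.

Lemma avg_shift (K : fieldType) L k d (g : G -> K) : (k < L)%N ->
  avg L (fun x => g (x + ev k d)) = avg L g.
Proof.
elim: L g => [//|L IH] g; rewrite ltnS leq_eqVlt => /orP[/eqP <-|kL] /=.
  by apply: eq_avg => x; rewrite sum_evec_shift.
rewrite -[RHS](IH _ kL); apply: eq_avg => x; congr (_ * _).
by apply: eq_bigr => c _; rewrite addrAC.
Qed.

Lemma avg_cyl (K : numFieldType) n L (g : G -> K) :
  (n <= L)%N -> cyl n g -> avg L g = avg n g.
Proof.
move=> /subnK <- cg; elim: (L - n)%N => [//|d IH]; rewrite addSn /= -IH.
apply: eq_avg => x; rewrite (eq_bigr (fun=> g x)).
  rewrite sumr_const card_ord -[g x *+ _]mulr_natl mulKf //.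
  by rewrite pnatr_eq0 -lt0n (leq_trans _ (m_ge2 _)).
move=> c _; apply: cg => k kn; rewrite vaddE evec_out ?addr0 //.
by rewrite neq_ltn (leq_trans kn) // leq_addl.
Qed.

Lemma avg_cst (K : numFieldType) L (a : K) : avg L (fun=> a) = a.
Proof. by rewrite (@avg_cyl _ 0). Qed.

Lemma ler_avg L (f g : G -> R) : (forall x, f x <= g x) -> avg L f <= avg L g.
Proof.
elim: L f g => [|L IH] f g fg /=; first exact: fg.
by apply: IH => x; rewrite ler_wpM2l ?invr_ge0 // ler_sum.
Qed.

Lemma avg_ge0 L (f : G -> R) : (forall x, 0 <= f x) -> 0 <= avg L f.
Proof. by move=> f0; rewrite -(avg0 R L) ler_avg. Qed.

Lemma normc_avg L (f : G -> C) : nrm (avg L f) <= avg L (fun x => nrm (f x)).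
Proof.
elim: L f => [//|L IH] f /=; apply: le_trans (IH _) _; apply: ler_avg => x.
rewrite Normc.normcM Normc.normcV normc_nat ler_wpM2l ?invr_ge0 //.
exact: normc_sum.
Qed.

(** For i != j, a shift by a coordinate vector that separates the two characters preserves the
    average and multiplies it by a number other than 1, so the average is 0. *)
Lemma avg_psi L i j : (i < M L)%N -> (j < M L)%N ->
  avg L (fun x => psi i x * ((psi j x)^*)%C) = (i == j)%:R.
Proof.
move=> iM jM; have [<-|ij] := eqVneq i j.
  rewrite -[RHS](@avg_cst (R[i] : numFieldType) L); apply: eq_avg => x.
  by rewrite normc_conjM // psi_normc.
have [k kL] := psi_separate R m_ge2 iM jM ij.
set w := psi i (ev k 1); set z := psi j (ev k 1) => wz.
set A := avg L _.
have : A = w * (z^*)%C * A.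
  rewrite /A -avgZ -(avg_shift 1 _ kL); apply: eq_avg => x.
  by rewrite !psiD // rmorphM /= -/w -/z; ring.
have z1 : z * (z^*)%C = 1 by rewrite normc_conjM // psi_normc.
move/eqP; rewrite -subr_eq0 -{1}[A]mul1r -mulrBl mulf_eq0 => /orP[|/eqP //].
rewrite subr_eq0 => /eqP h; move: wz; rewrite -[w]mulr1 -z1.
by rewrite mulrCA -h mulr1 eqxx.
Qed.

Lemma boxB s x y : box s (x - y) = box s (y - x).
Proof.
by rewrite -(opprB y); apply/eq_forallb => k; rewrite voppE oppr_eq0.
Qed.

(** At each level exactly one of the m_s values of the new coordinate keeps u in the coset of x,
    hence a factor 1 / m_s. *)
Lemma avg_box L s x : (s <= L)%N ->
  avg L (fun u => (box s (x - u))%:R : R) = (M s)%:R^-1.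
Proof.
move=> sL; rewrite (@avg_cyl _ s) //; last first.
  move=> u v uv; congr ((nat_of_bool _)%:R); apply: box_cyl => k ks.
  by rewrite !vaddE !voppE uv.
elim: s {sL} => [|s IH] /=.
  by rewrite M0 invr1 (_ : box 0 _) //; apply/boxP.
rewrite MS natrM invfM mulrC -IH -avgZ; apply: eq_avg => u; congr (_ * _).
have [d dE] : exists d : 'I_(m s), val d = nat_of_ord ((x - u) s).
  have xm : ((x - u)%R s < m s)%N.
    by have := ltn_ord ((x - u) s); rewrite [X in (_ < X)%N -> _]Zp_m.
  by exists (Ordinal xm).
have e (c : 'I_(m s)) : box s.+1 (x - (u + ev s c)) = box s (x - u) && (d == c).
  rewrite boxS; congr (_ && _).
    apply: box_cyl => k ks; rewrite !vaddE !voppE vaddE evec_out ?addr0 //.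
    by rewrite neq_ltn ks.
  rewrite opprD addrA vaddE voppE evec_in subr_eq0.
  apply/eqP/eqP => [h|<- /=]; last by rewrite dE natr_Zp.
  by apply/val_inj; rewrite dE h val_Zp_nat // modn_small.
rewrite (bigD1 d) //= e eqxx andbT big1 ?addr0 // => c.
by rewrite eq_sym e => /negbTE ->; rewrite andbF.
Qed.

(** Convolution with D_j, computed by orthogonality: only the diagonal terms k = i < j survive. *)
Lemma avg_partial_sum a L j x : (j <= M L)%N ->
  avg L (fun u => partial_sum a (M L) u * dirichlet R j (x - u)) =
  partial_sum a j x :> C.
Proof.
move=> jL; rewrite (@eq_avg _ _ _ (fun u => \sum_(k < M L) \sum_(i < j)
    a k * psi i x * (psi k u * ((psi i u)^*)%C))); last first.
  move=> u; rewrite /partial_sum mulr_suml; apply: eq_bigr => k _.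
  rewrite mulr_sumr; apply: eq_bigr => i _.
  by rewrite psiD // psiN //; ring.
rewrite avg_sum.
rewrite (eq_bigr (fun k : 'I_(M L) => \sum_(i < j) a k * psi i x * (k == i :> nat)%:R)); last first.
  move=> k _; rewrite avg_sum; apply: eq_bigr => i _.
  by rewrite avgZ avg_psi // (leq_trans (ltn_ord i)).
rewrite exchange_big /=; apply: eq_bigr => i _.
rewrite (bigD1 (widen_ord jL i)) //= eqxx mulr1 big1 ?addr0 // => k ki.
rewrite (_ : (k == i :> nat) = false) ?mulr0 //.
by apply/negbTE; apply: contra ki => /eqP e; apply/eqP/val_inj.
Qed.

Lemma avg_fejer_sum a L k x : (k <= M L)%N ->
  \sum_(j < k) partial_sum a j.+1 x =
  avg L (fun u => partial_sum a (M L) u * fejer_sum R k (x - u)) :> C.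
Proof.
move=> kL; under eq_bigr => j _.
  rewrite -(@avg_partial_sum a L j.+1 x) ?(leq_trans (ltn_ord j)) //.
  over.
rewrite -avg_sum; apply: eq_avg => u.
by rewrite /fejer_sum mulr_sumr.
Qed.

End averages.

(** * The doubling envelope and local means *)

Section powers.
Context (R : realType) (p : R) (p0 : 0 < p) (p1 : p <= 1).

Lemma powR_subadditive (a b : R) : 0 <= a -> 0 <= b ->
  (a + b) `^ p <= a `^ p + b `^ p.
Proof.
move=> a0 b0; have [ab0|abN0] := eqVneq (a + b) 0.
  by rewrite ab0 powR0 ?gt_eqF // addr_ge0 ?powR_ge0.
have ab : 0 < a + b by rewrite lt_neqAle eq_sym abN0 addr_ge0.
(* This is t <= t^p for 0 <= t <= 1, with t = c / (a + b). It is used for c = a and c = b, whose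
   ratios sum to 1. *)
have le1 c : 0 <= c -> c <= a + b -> c / (a + b) * (a + b) `^ p <= c `^ p.
  move=> c0 cab; have [->|cN0] := eqVneq c 0; first by rewrite !mul0r powR_ge0.
  have -> : c `^ p = (c / (a + b)) `^ p * (a + b) `^ p.
    by rewrite -powRM ?divr_ge0 // 1?ltW // divfK.
  rewrite ler_wpM2r ?powR_ge0 //.
  have cgt0 : 0 < c by rewrite lt_neqAle eq_sym cN0.
  by rewrite ger1_powR // divr_gt0 //= ler_pdivrMr // mul1r.
have := lerD (le1 a a0 _) (le1 b b0 _); rewrite lerDl lerDr => /(_ b0 a0).
by rewrite -mulrDl -mulrDl divff // mul1r.
Qed.

Lemma powR_sum (I : Type) (r : seq I) (F : I -> R) : (forall i, 0 <= F i) ->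
  (\sum_(i <- r) F i) `^ p <= \sum_(i <- r) F i `^ p.
Proof.
move=> F0; elim: r => [|i r IH]; first by rewrite !big_nil powR0 // gt_eqF.
rewrite !big_cons (le_trans (powR_subadditive _ _)) ?sumr_ge0 //.
by rewrite lerD2l.
Qed.

Lemma powR_bool (b : bool) : (b%:R : R) `^ p = b%:R.
Proof. by case: b; rewrite ?powR1 // powR0 // gt_eqF. Qed.

Lemma ler_powR_l (a b : R) : 0 <= a -> a <= b -> a `^ p <= b `^ p.
Proof.
move=> a0 ab; rewrite ge0_ler_powR ?nnegrE ?(ltW p0) //.
exact: le_trans ab.
Qed.

(** The value moves only when [u l] exceeds it, and then to [2 * u l]; the factor 2 makes each
    change more than double it. *)
Fixpoint envelope (u : nat -> R) (l : nat) : R :=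
  if l is l'.+1
  then if u l <= envelope u l' then envelope u l' else 2 * u l
  else 2 * u 0%N.

Definition envelope_jump (u : nat -> R) (l : nat) : R :=
  if l is l'.+1 then envelope u l - envelope u l' else envelope u 0.

Section envelope_theory.
Variable u : nat -> R.
Hypothesis u0 : forall l, 0 <= u l.

Lemma envelope_ge l : u l <= envelope u l.
Proof.
by case: l => [|l] /=; last case: ifPn => // _; have := u0 0; [|have := u0 l.+1]; lra.
Qed.

Lemma envelope_ge0 l : 0 <= envelope u l.
Proof. exact: le_trans (envelope_ge l). Qed.

Lemma envelope_jump_ge0 l : 0 <= envelope_jump u l.
Proof.
case: l => [|l]; first exact: envelope_ge0.
rewrite /envelope_jump subr_ge0 /=; case: ifPn => //; rewrite -ltNge => h.
by have := u0 l.+1; lra.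
Qed.

Lemma sum_envelope_jump l : \sum_(i < l.+1) envelope_jump u i = envelope u l.
Proof.
elim: l => [|l IH]; first by rewrite big_ord1.
transitivity (envelope u l + envelope_jump u l.+1); last exact: subrKC.
by rewrite big_ord_recr -IH.
Qed.

Lemma envelope_le l : exists2 i, (i <= l)%N & envelope u l = 2 * u i.
Proof.
elim: l => [|l [i il e]]; first by exists 0%N.
rewrite [envelope _ _]/=; case: ifPn => _; last by exists l.+1.
by exists i => //; exact: leqW.
Qed.

(** Sum of the geometric series of ratio 2^(-p). *)
Definition envelope_const : R := (1 - 2 `^ (- p))^-1.

Lemma pow2N_lt1 (r : R) : 0 < r -> 2 `^ (- r) < 1.
Proof.
move=> r0; rewrite powRN invf_lt1 ?powR_gt0 //.
have {1}-> : 1 = 1 `^ r :> R by rewrite powR1.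
by rewrite gt0_ltr_powR ?nnegrE //; lra.
Qed.

(* The envelope at least doubles at each of its jumps, so the p-th powers of
   its jumps are dominated by a geometric series. *)
Lemma sum_envelope_jump_powR l :
  \sum_(i < l.+1) envelope_jump u i `^ p <= envelope_const * envelope u l `^ p.
Proof.
have q1 := pow2N_lt1 p0; set q := 2 `^ (- p) in q1.
have q0 : 0 <= q := powR_ge0 _ _.
have Kq : envelope_const = 1 + envelope_const * q.
  by rewrite /envelope_const -/q; field; rewrite subr_eq0 gt_eqF.
have K0 : 0 <= envelope_const by rewrite invr_ge0 subr_ge0 ltW.
elim: l => [|l IH].
  by rewrite big_ord1 /= ler_peMl ?powR_ge0 // Kq lerDl mulr_ge0.
rewrite big_ord_recr.
apply: (@le_trans _ _ (envelope_const * envelope u l `^ p + envelope_jump u l.+1 `^ p)).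
  exact: lerD.
rewrite /envelope_jump /=; case: ifPn => [_|].
  by rewrite subrr powR0 ?gt_eqF // addr0.
rewrite -ltNge => h; have e0 := envelope_ge0 l.
(* With K = 1 + K 2^(-p), the 1 pays for the new jump and K 2^(-p) for the earlier ones, the old
   envelope being at most half of the new one. *)
rewrite Kq [leRHS]mulrDl mul1r addrC -Kq; apply: lerD.
  by apply: ler_powR_l; lra.
rewrite -mulrA ler_wpM2l // /q.
have -> : 2 `^ (- p) * (2 * u l.+1) `^ p = u l.+1 `^ p.
  by rewrite powRM // mulrA powRN mulVf ?mul1r // gt_eqF ?powR_gt0.
by apply: ler_powR_l => //; exact: ltW.
Qed.

End envelope_theory.

Lemma envelope_ext u v l : (forall i, (i <= l)%N -> u i = v i) ->
  envelope u l = envelope v l.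
Proof.
elim: l => [|l IH] uv /=; first by rewrite uv.
by rewrite IH ?uv // => i il; rewrite uv // leqW.
Qed.

Lemma envelope_jump_ext u v l : (forall i, (i <= l)%N -> u i = v i) ->
  envelope_jump u l = envelope_jump v l.
Proof.
case: l => [|l] uv; rewrite /envelope_jump; first exact: envelope_ext.
by rewrite !(@envelope_ext u v) // => i il; rewrite uv // leqW.
Qed.

Lemma geometric_tail (q : R) (a N : nat) : 0 <= q < 1 ->
  \sum_(l < N) (if (a <= l)%N then q ^+ (l - a) else 0) <= (1 - q)^-1.
Proof.
move=> /andP[q0 q1].
have K0 : 0 < (1 - q)^-1 by rewrite invr_gt0 subr_gt0.
elim: a N => [|a IH] [|N]; rewrite ?big_ord0 ?(ltW K0) //.
  rewrite (eq_bigr (fun i : 'I_N.+1 => q ^+ i)) => [|i _]; last by rewrite subn0.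
  rewrite -[leRHS]mul1r ler_pdivlMr ?subr_gt0 // mulrC.
  rewrite -[1 - q]opprB mulNr -subrX1 opprB gerBl exprn_ge0 //.
rewrite big_ord_recl /= add0r; exact: IH.
Qed.

End powers.

(** * Local means of the martingale over the cosets of I_s *)

Section hardy_estimates.
Context (R : realType) (m : nat -> nat) (m_ge2 : forall k, (2 <= m k)%N).
Context (p : R) (p0 : 0 < p) (p1 : p <= 1).
Local Notation G := (vilenkin m).
Local Notation C := R[i].
Local Notation nrm := (@Normc.normc R).
Local Notation M := (M m).
Local Notation ev := (evec m).

(** A converse to Jensen's inequality for an average of M_n values: t^p is subadditive, and each
    coordinate costs m_n^(1-p) because m_n^(1-p) / m_n = m_n^(-p). *)
Lemma avg_powR n (g : G -> R) : (forall x, 0 <= g x) ->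
  avg n g `^ p <= (M n)%:R `^ (1 - p) * avg n (fun x => g x `^ p).
Proof.
elim: n g => [|n IH] g g0 /=; first by rewrite M0 powR1 mul1r.
apply: le_trans (IH _ _) _ => [x|]; first by rewrite mulr_ge0 ?invr_ge0 ?sumr_ge0.
rewrite MS natrM powRM // -mulrA ler_wpM2l ?powR_ge0 // -avgZ.
apply: ler_avg => x; rewrite powRM ?invr_ge0 ?sumr_ge0 //.
rewrite mulrA; have -> : (m n)%:R `^ (1 - p) * (m n)%:R^-1 = (m n)%:R^-1 `^ p.
  have m0 : 0 < (m n)%:R :> R by rewrite ltr0n (leq_trans _ (m_ge2 n)).
  rewrite -(powR_inv1 (ltW m0)) -powRrM -powRD; first by congr (_ `^ _); lra.
  by rewrite (gt_eqF m0) implybT.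
by rewrite ler_wpM2l ?powR_ge0 // powR_sum.
Qed.

(** The loss is governed by the number n of coordinates that g depends on, not by L; this is where
    the gain for early jumps comes from. *)
Lemma avg_powR_cyl n L (g : G -> R) : (n <= L)%N -> cyl n g ->
  (forall x, 0 <= g x) ->
  avg L g `^ p <= (M n)%:R `^ (1 - p) * avg L (fun x => g x `^ p).
Proof.
move=> nL cg g0; rewrite !(avg_cyl m_ge2 nL) //; first exact: avg_powR.
by move=> x y xy; rewrite (cg _ _ xy).
Qed.

Variable a : nat -> C.

Definition level_norm (x : G) (l : nat) : R := nrm (partial_sum a (M l) x).

Lemma level_norm_ge0 x l : 0 <= level_norm x l.
Proof. exact: normc_ge0. Qed.

Lemma partial_sum_cyl L n : (n <= M L)%N -> cyl L (@partial_sum R m a n).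
Proof.
move=> nL x y xy; apply: eq_bigr => k _; congr (_ * _).
by apply: (psi_cyl R m_ge2 (leq_trans (ltn_ord k) nL)); exact: xy.
Qed.

Lemma level_norm_cyl L l : (l <= L)%N -> cyl L (level_norm^~ l).
Proof.
by move=> lL x y xy; rewrite /level_norm (partial_sum_cyl (M_mono m_ge2 lL) xy).
Qed.

Definition jump i x : R := envelope_jump (level_norm x) i.

Lemma jump_cyl i : cyl i (jump i).
Proof.
move=> x y xy; apply: envelope_jump_ext => j ji; apply: (level_norm_cyl ji).
exact: xy.
Qed.

Lemma jump_ge0 i x : 0 <= jump i x.
Proof. exact/envelope_jump_ge0/level_norm_ge0. Qed.

(** Not normalised: the integral of |f_L| over the coset x + I_s, that is, 1 / M_s times the mean
    there. *)
Definition local_mean L s x : R :=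
  avg L (fun u => level_norm u L * (box s (x - u))%:R).

Lemma local_mean_ge0 L s x : 0 <= local_mean L s x.
Proof. by apply: avg_ge0 => u; rewrite mulr_ge0 // level_norm_ge0. Qed.

(** |f_L| is at most the sum of the jumps up to L. The i-th jump restricted to a coset of I_s
    depends on max(i, s) coordinates, which fixes the loss in [avg_powR_cyl]; averaging the
    indicator over x gives 1 / M_s. *)
Lemma local_mean_powR N L s : (s <= L)%N -> (L <= N)%N ->
  avg N (fun x => local_mean L s x `^ p) <=
  (M s)%:R^-1 * \sum_(i < L.+1)
      (M (maxn i s))%:R `^ (1 - p) * avg N (fun x => jump i x `^ p).
Proof.
move=> sL LN.
have pt x : local_mean L s x `^ p <= \sum_(i < L.+1) (M (maxn i s))%:R `^ (1 - p) *
    avg L (fun u => jump i u `^ p * (box s (x - u))%:R).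
  apply: (@le_trans _ _ ((\sum_(i < L.+1) avg L (fun u => jump i u * (box s (x - u))%:R)) `^ p)).
    apply: ler_powR_l => //; first exact: local_mean_ge0.
    rewrite -avg_sum; apply: ler_avg => u; rewrite -mulr_suml ler_wpM2r //.
    rewrite (sum_envelope_jump (level_norm u)).
    exact/envelope_ge/level_norm_ge0.
  apply: le_trans (powR_sum p0 p1 _ _) _ => [i|].
    by apply: avg_ge0 => u; rewrite mulr_ge0 // jump_ge0.
  apply: ler_sum => i _.
  apply: le_trans (@avg_powR_cyl (maxn i s) _ _ _ _ _) _.
  - by rewrite geq_max -ltnS ltn_ord.
  - move=> u v uv.
    have -> : jump i u = jump i v.
      by apply: jump_cyl => k ki; apply: uv; rewrite (leq_trans ki) // leq_maxl.
    have -> // : box s (x - u) = box s (x - v).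
    apply: box_cyl => k ks.
    by rewrite !vaddE !voppE uv // (leq_trans ks) // leq_maxr.
  - by move=> u; rewrite mulr_ge0 // jump_ge0.
  rewrite ler_wpM2l ?powR_ge0 //; apply: ler_avg => u.
  by rewrite powRM ?jump_ge0 // powR_bool.
apply: le_trans; first by apply: ler_avg; exact: pt.
rewrite avg_sum mulr_sumr; apply: ler_sum => i _.
rewrite avgZ mulrCA ler_wpM2l ?powR_ge0 // avg_swap.
have iL : (i <= L)%N by rewrite -ltnS ltn_ord.
have cj : cyl i (fun x => jump i x `^ p).
  by move=> x y xy; rewrite (jump_cyl xy).
(* The jump depends on i <= L <= N coordinates only, so its averages over N and over L coordinates
   agree. *)
rewrite (avg_cyl m_ge2 (leq_trans iL LN) cj) -(avg_cyl m_ge2 iL cj) -avgZ.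
apply: ler_avg => u; rewrite avgZ mulrC.
rewrite (@eq_avg _ _ _ _ (fun x => (box s (u - x))%:R)) => [|x]; last by rewrite boxB.
by rewrite avg_box // (leq_trans sL).
Qed.

End hardy_estimates.

(** * Weighted estimates for Fejer sums *)

Section weighted_estimates.
Context (R : realType) (m : nat -> nat) (m_ge2 : forall k, (2 <= m k)%N).
Context (B : nat) (mB : forall k, (m k <= B)%N).
Context (p : R) (p0 : 0 < p) (p12 : p < 1 / 2).
Local Notation G := (vilenkin m).
Local Notation C := R[i].
Local Notation nrm := (@Normc.normc R).
Local Notation M := (M m).
Local Notation ev := (evec m).

Let p1 : p <= 1. Proof. by have h := p12; lra. Qed.
Let MR_gt0 n : 0 < (M n)%:R :> R. Proof. by rewrite ltr0n M_gt0. Qed.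
Let MR_neq0 n : (M n)%:R != 0 :> R. Proof. by rewrite gt_eqF. Qed.

Lemma M_powN_ratio (r : R) k n : 0 < r -> (k <= n)%N ->
  (M n)%:R `^ (- r) <= (2 `^ (- r)) ^+ (n - k) * (M k)%:R `^ (- r).
Proof.
move=> r0 /subnK <-; rewrite addnK; elim: (n - k)%N => [|d IH].
  by rewrite add0n expr0 mul1r.
rewrite exprS -mulrA; apply: le_trans (ler_wpM2l (powR_ge0 _ _) IH).
rewrite -powRM // !powRN lef_pV2 ?posrE ?powR_gt0 ?mulr_gt0 //.
apply: ler_powR_l => //.
by rewrite -natrM ler_nat mulnC leq_M2.
Qed.

Lemma M_powN_le (r : R) n : 0 < r -> (M n)%:R `^ (- r) <= (2 `^ (- r)) ^+ n.
Proof.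
move=> r0; have := M_powN_ratio r0 (leq0n n).
by rewrite subn0 M0 powR1 mulr1.
Qed.

Lemma M_powN_succ (r : R) n : 0 < r ->
  (M n)%:R `^ (- r) <= B%:R `^ r * (M n.+1)%:R `^ (- r).
Proof.
move=> r0; rewrite !powRN ler_pdivlMr ?powR_gt0 // mulrC ler_pdivrMr ?powR_gt0 //.
rewrite -powRM //; apply: ler_powR_l => //.
by rewrite -natrM ler_nat MS mulnC leq_mul2r mB orbT.
Qed.

Lemma sum_M_powR n :
  \sum_(t < n) (M t)%:R `^ p <= (2 `^ p - 1)^-1 * (M n)%:R `^ p.
Proof.
have q1 : 1 < 2 `^ p :> R.
  by have := pow2N_lt1 p0; rewrite powRN invf_lt1 ?powR_gt0.
have q0 : 0 < 2 `^ p - 1 by rewrite subr_gt0.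
elim: n => [|n IH]; first by rewrite big_ord0 mulr_ge0 ?invr_ge0 ?ltW ?powR_gt0.
rewrite big_ord_recr/=; apply: le_trans (lerD IH (lexx _)) _.
(* The induction closes because 1 / (2^p - 1) + 1 = 2^p / (2^p - 1) and 2 M_n <= M_(n+1). *)
have -> : (2 `^ p - 1)^-1 * (M n)%:R `^ p + (M n)%:R `^ p =
    (2 `^ p - 1)^-1 * (2 * (M n)%:R) `^ p.
  by rewrite powRM //; field; rewrite gt_eqF.
rewrite ler_wpM2l ?invr_ge0 ?(ltW q0) //; apply: ler_powR_l => //.
by rewrite -natrM ler_nat mulnC leq_M2.
Qed.

Variable a : nat -> C.

(** The convolution of |f_L| with the kernel bound of [norm_fejer_sum], written through local
    means. *)
Definition fejer_majorant L x : R := kerC R B * \sum_(s < L) (M s)%:R *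
  ((M s)%:R * local_mean a L s x +
   \sum_(t < s) (M t)%:R * \sum_(c < m t) local_mean a L s (x - ev t c)).

Lemma fejer_majorant_ge0 L x : 0 <= fejer_majorant L x.
Proof.
rewrite mulr_ge0 ?kerC_ge0 // sumr_ge0 // => s _; rewrite mulr_ge0 //.
rewrite addr_ge0 ?mulr_ge0 ?local_mean_ge0 // sumr_ge0 // => t _.
by rewrite mulr_ge0 // sumr_ge0 // => c _; exact: local_mean_ge0.
Qed.

Lemma fejer_majorant_cyl L : cyl L (fejer_majorant L).
Proof.
have lm s x y : (s <= L)%N -> (forall k, (k < L)%N -> x k = y k) ->
    local_mean a L s x = local_mean a L s y.
  move=> sL xy; apply: eq_avg => u; congr (_ * (nat_of_bool _)%:R).
  by apply: box_cyl => k ks; rewrite !vaddE xy // (leq_trans ks).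
move=> x y xy; congr (_ * _); apply: eq_bigr => s _; congr (_ * (_ * _ + _)).
  exact/lm/xy/ltnW.
apply: eq_bigr => t _; congr (_ * _); apply: eq_bigr => c _.
by apply: lm => [|k kL]; [exact: ltnW | rewrite !vaddE xy].
Qed.

Lemma norm_sum_partial_sum L k x : (k < M L)%N ->
  nrm (\sum_(j < k) partial_sum a j.+1 x) <= fejer_majorant L x.
Proof.
move=> kL; rewrite (avg_fejer_sum m_ge2 _ _ (ltnW kL)).
apply: le_trans (normc_avg _ _) _.
apply: (@le_trans _ _ (avg L (fun u => kerC R B * \sum_(s < L)
    (level_norm a u L * kerP R s (x - u))))).
  apply: ler_avg => u; rewrite Normc.normcM -mulr_sumr mulrCA.
  by rewrite ler_wpM2l ?normc_ge0 // norm_fejer_sum.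
rewrite avgZ ler_wpM2l ?kerC_ge0 // avg_sum; apply: ler_sum => s _.
rewrite le_eqVlt; apply/orP; left; apply/eqP.
rewrite /local_mean -!avgZ /kerP.
rewrite (eq_bigr (fun t : 'I_s => avg L (fun u => (M t)%:R *
  \sum_(c < m t) (level_norm a u L * (box s (x - ev t c - u))%:R)))); last first.
  by move=> t _; rewrite avgZ avg_sum.
rewrite -avg_sum -avgD -avgZ; apply: eq_avg => u.
rewrite mulrCA; congr (_ * _); rewrite mulrDr; congr (_ + _).
  by rewrite mulrCA.
rewrite mulr_sumr; apply: eq_bigr => t _; rewrite mulrCA mulr_sumr; congr (_ * _).
by apply: eq_bigr => c _; rewrite addrAC.
Qed.

Lemma avg_local_mean_shift N L s t c : (t < N)%N ->
  avg N (fun x : G => local_mean a L s (x - ev t c) `^ p) =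
  avg N (fun x : G => local_mean a L s x `^ p).
Proof.
move=> tN; rewrite -(avg_shift m_ge2 c _ tN); apply: eq_avg => x.
by rewrite addrK.
Qed.

Definition fejer_const : R := kerC R B `^ p * (1 + B%:R * (2 `^ p - 1)^-1).

(** Translates of a local mean have the same average, and the sum of M_t^p over t < s is at most a
    multiple of M_s^p. The translated cosets thus cost no more than the coset itself, namely
    M_s^(2p). *)
Lemma fejer_majorant_powR N L : (L <= N)%N ->
  avg N (fun x : G => fejer_majorant L x `^ p) <= fejer_const *
  \sum_(s < L) (M s)%:R `^ (2 * p) * avg N (fun x : G => local_mean a L s x `^ p).
Proof.
move=> LN.
pose lm s (x : G) := local_mean a L s x `^ p.
have pt x : fejer_majorant L x `^ p <= kerC R B `^ p * \sum_(s < L) (M s)%:R `^ p *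
    ((M s)%:R `^ p * lm s x + \sum_(t < s) (M t)%:R `^ p * \sum_(c < m t) lm s (x - ev t c)).
  have s0 (s : nat) (t : nat) : 0 <= \sum_(c < m t) local_mean a L s (x - ev t c).
    by rewrite sumr_ge0 // => c _; exact: local_mean_ge0.
  have t0 (s : nat) : 0 <= \sum_(t < s) (M t)%:R * \sum_(c < m t) local_mean a L s (x - ev t c).
    by rewrite sumr_ge0 // => t _; rewrite mulr_ge0.
  have l0 s : 0 <= local_mean a L s x := local_mean_ge0 _ _ _ _.
  have st0 s : 0 <= (M s)%:R * (M s)%:R * local_mean a L s x.
    by rewrite !mulr_ge0.
  rewrite /fejer_majorant powRM ?kerC_ge0 ?ler_wpM2l ?powR_ge0 //; last first.
    by rewrite sumr_ge0 // => s _; rewrite mulr_ge0 // addr_ge0 // mulr_ge0.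
  apply: le_trans (powR_sum p0 p1 _ _) _ => [s|].
    by rewrite mulr_ge0 // addr_ge0 // mulr_ge0.
  apply: ler_sum => s _; rewrite powRM ?addr_ge0 ?mulr_ge0 //.
  rewrite ler_wpM2l ?powR_ge0 //.
  apply: le_trans (powR_subadditive p0 p1 _ _) _; rewrite ?mulr_ge0 //.
  rewrite powRM // lerD2l.
  apply: le_trans (powR_sum p0 p1 _ _) _ => [t|]; first by rewrite mulr_ge0.
  apply: ler_sum => t _; rewrite powRM // ler_wpM2l ?powR_ge0 //.
  by apply: powR_sum => // c; exact: local_mean_ge0.
apply: le_trans; first by apply: ler_avg; exact: pt.
rewrite avgZ /fejer_const -mulrA ler_wpM2l ?powR_ge0 // avg_sum mulr_sumr.
apply: ler_sum => s _; rewrite avgZ avgD avgZ avg_sum.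
set A := avg N _; have A0 : 0 <= A by apply: avg_ge0 => x; exact: powR_ge0.
have h : \sum_(t < s) avg N (fun x => (M t)%:R `^ p * \sum_(c < m t) lm s (x - ev t c))
    <= B%:R * ((2 `^ p - 1)^-1 * (M s)%:R `^ p) * A.
  apply: (@le_trans _ _ (\sum_(t < s) (M t)%:R `^ p * (B%:R * A))).
    apply: ler_sum => t _; rewrite avgZ ler_wpM2l ?powR_ge0 // avg_sum.
    rewrite (eq_bigr (fun=> A)) => [|c _]; last first.
      by rewrite /lm avg_local_mean_shift // (ltn_trans (ltn_ord t)) // (leq_trans (ltn_ord s)).
    by rewrite sumr_const card_ord -[A *+ _]mulr_natl ler_wpM2r // ler_nat.
  rewrite -mulr_suml [leLHS]mulrA ler_wpM2r // mulrC ler_wpM2l //.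
  exact: sum_M_powR.
apply: (@le_trans _ _ ((M s)%:R `^ p * ((M s)%:R `^ p * A + B%:R * ((2 `^ p - 1)^-1 * (M s)%:R `^ p) * A))).
  by rewrite ler_wpM2l ?powR_ge0 // lerD2l.
rewrite le_eqVlt; apply/orP; left; apply/eqP.
have -> : (M s)%:R `^ (2 * p) = (M s)%:R `^ p * (M s)%:R `^ p :> R.
  by rewrite -powRD ?MR_neq0 ?implybT //; congr (_ `^ _); ring.
by ring.
Qed.

Definition geo (r : R) : R := (1 - 2 `^ (- r))^-1.

Lemma geo_ge0 r : 0 < r -> 0 <= geo r.
Proof. by move=> r0; rewrite invr_ge0 subr_ge0 ltW // pow2N_lt1. Qed.

Lemma sum_geo (r : R) N : 0 < r -> \sum_(l < N) (2 `^ (- r)) ^+ l <= geo r.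
Proof.
move=> r0; have := @geometric_tail R (2 `^ (- r)) 0 N.
rewrite powR_ge0 pow2N_lt1 // => /(_ isT); apply: le_trans.
by apply: ler_sum => l _; rewrite subn0.
Qed.

Lemma sum_geo_tail (r : R) k N : 0 < r ->
  \sum_(l < N) (if (k <= l)%N then (2 `^ (- r)) ^+ (l - k) else 0) <= geo r.
Proof. by move=> r0; apply: geometric_tail; rewrite powR_ge0 pow2N_lt1. Qed.

Definition sum_fejer_const : R :=
  fejer_const * (B%:R `^ (1 - p) * (geo (1 - 2 * p) * geo (1 - p))).

Lemma fejer_const_ge0 : 0 <= fejer_const.
Proof.
rewrite mulr_ge0 ?powR_ge0 // addr_ge0 // mulr_ge0 // invr_ge0 subr_ge0 ltW //.
by have := pow2N_lt1 p0; rewrite powRN invf_lt1 ?powR_gt0.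
Qed.

(** With k = max(i, s), the total weight of the i-th jump is M_l^(p-1) M_s^(2p-1) M_k^(1-p). The
    factor M_s^(2p-1) is at most [q2 ^+ s], summable since p < 1/2, and (M_k / M_l)^(1-p) decays
    geometrically in l, up to B^(1-p). *)
Lemma sum_fejer_majorant N :
  \sum_(l < N) (M l)%:R `^ (p - 1) * avg N (fun x : G => fejer_majorant l.+1 x `^ p)
  <= sum_fejer_const * \sum_(i < N.+1) avg N (fun x : G => jump a i x `^ p).
Proof.
pose d i := avg N (fun x : G => jump a i x `^ p).
have d0 i : 0 <= d i by apply: avg_ge0 => x; exact: powR_ge0.
have h12 := p12; have r1 : 0 < 1 - p by lra.
have r2 : 0 < 1 - 2 * p by lra.
pose q1 : R := 2 `^ (- (1 - p)); pose q2 : R := 2 `^ (- (1 - 2 * p)).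
have q10 : 0 <= q1 := powR_ge0 _ _.
have q20 : 0 <= q2 := powR_ge0 _ _.
pose e l k := if (k <= l)%N then q1 ^+ (l - k) else 0.
have e0 l k : 0 <= e l k by rewrite /e; case: ifP => // _; rewrite exprn_ge0.
have step (l : 'I_N) : (M l)%:R `^ (p - 1) * avg N (fun x : G => fejer_majorant l.+1 x `^ p)
   <= fejer_const * B%:R `^ (1 - p) *
      \sum_(s < N) \sum_(i < N.+1) q2 ^+ s * (e l.+1 (maxn i s) * d i).
  apply: (@le_trans _ _ ((M l)%:R `^ (p - 1) * (fejer_const *
     \sum_(s < l.+1) (M s)%:R `^ (2 * p) * ((M s)%:R^-1 * \sum_(i < l.+2)
      (M (maxn i s))%:R `^ (1 - p) * d i)))).
    rewrite ler_wpM2l ?powR_ge0 //.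
    apply: le_trans (fejer_majorant_powR _) _ => //.
    rewrite ler_wpM2l ?fejer_const_ge0 //; apply: ler_sum => s _.
    rewrite ler_wpM2l ?powR_ge0 //.
    by apply: local_mean_powR => //; exact: ltnW.
  rewrite mulrCA -mulrA ler_wpM2l ?fejer_const_ge0 // mulr_sumr mulr_sumr.
  rewrite (big_ord_widen N (fun s => (M l)%:R `^ (p - 1) * ((M s)%:R `^ (2 * p) * ((M s)%:R^-1 * \sum_(i < l.+2)
      (M (maxn i s))%:R `^ (1 - p) * d i)))) // big_mkcond /=.
  apply: ler_sum => s _; case: ifPn => [sl|_]; last first.
    by rewrite mulr_ge0 ?powR_ge0 // sumr_ge0 // => i _; rewrite !mulr_ge0 ?exprn_ge0.
  rewrite !mulr_sumr (big_ord_widen N.+1 (fun i => (M l)%:R `^ (p - 1) * ((M s)%:R `^ (2 * p) * ((M s)%:R^-1 *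
      ((M (maxn i s))%:R `^ (1 - p) * d i))))) ?ltnS // big_mkcond /=.
  apply: ler_sum => i _; case: ifPn => [il|_]; last first.
    by rewrite !mulr_ge0 ?exprn_ge0 ?powR_ge0.
  have k_le : (maxn i s <= l.+1)%N by rewrite geq_max -ltnS il ltnW.
  rewrite /e k_le.
  have h1 : (M s)%:R `^ (2 * p) * (M s)%:R^-1 <= q2 ^+ s.
    rewrite -(powR_inv1 (ltW (MR_gt0 s))) -powRD ?MR_neq0 ?implybT //.
    have -> : 2 * p + -1 = - (1 - 2 * p) by ring.
    exact: M_powN_le.
  have h2 : (M l)%:R `^ (p - 1) * (M (maxn i s))%:R `^ (1 - p) <=
      B%:R `^ (1 - p) * q1 ^+ (l.+1 - maxn i s).
    rewrite -ler_pdivlMr ?powR_gt0 // -powRN -mulrA.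
    have -> : p - 1 = - (1 - p) by ring.
    apply: le_trans (M_powN_succ _ r1) _; rewrite ler_wpM2l ?powR_ge0 //.
    exact: M_powN_ratio.
  have -> : (M l)%:R `^ (p - 1) * ((M s)%:R `^ (2 * p) * ((M s)%:R^-1 *
      ((M (maxn i s))%:R `^ (1 - p) * d i))) =
    ((M s)%:R `^ (2 * p) * (M s)%:R^-1) * (((M l)%:R `^ (p - 1) * (M (maxn i s))%:R `^ (1 - p)) * d i) by ring.
  have -> : B%:R `^ (1 - p) * (q2 ^+ s * (q1 ^+ (l.+1 - maxn i s) * d i)) =
    q2 ^+ s * ((B%:R `^ (1 - p) * q1 ^+ (l.+1 - maxn i s)) * d i) by ring.
  apply: ler_pM => //; rewrite ?mulr_ge0 ?powR_ge0 ?invr_ge0 //.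
  by rewrite ler_wpM2r.
apply: le_trans (ler_sum _ (fun l _ => step l)) _.
rewrite -mulr_sumr /sum_fejer_const -!(mulrA fejer_const).
rewrite (ler_wpM2l fejer_const_ge0) // -!mulrA ler_wpM2l ?powR_ge0 // exchange_big /=.
apply: (@le_trans _ _ (\sum_(s < N) q2 ^+ s * (geo (1 - p) * \sum_(i < N.+1) d i))).
  apply: ler_sum => s _; rewrite exchange_big /= !mulr_sumr.
  apply: ler_sum => i _; rewrite -mulr_sumr -mulr_suml ler_wpM2l ?exprn_ge0 //.
  rewrite ler_wpM2r //.
  (* The sum runs over the indices l + 1 with l < N, so the tail over N + 1 indices has one extra
     nonnegative term, at 0. *)
  have := sum_geo_tail (maxn i s) N.+1 r1; rewrite big_ord_recl /=.
  by apply: le_trans; rewrite lerDr; case: ifP => // _; rewrite exprn_ge0.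
rewrite -mulr_suml ler_wpM2r ?sum_geo //.
by rewrite mulr_ge0 ?geo_ge0 // sumr_ge0.
Qed.

End weighted_estimates.

(** * Riesz sums *)

Section riesz_sums.
Context (R : realType) (m : nat -> nat) (m_ge2 : forall k, (2 <= m k)%N).
Context (B : nat) (mB : forall k, (m k <= B)%N).
Context (p : R) (p0 : 0 < p) (p12 : p < 1 / 2).
Local Notation G := (vilenkin m).
Local Notation C := R[i].
Local Notation nrm := (@Normc.normc R).
Local Notation M := (M m).

Let MR_gt0 n : 0 < (M n)%:R :> R. Proof. by rewrite ltr0n M_gt0. Qed.

Lemma sum_levels (V : nmodType) (g : nat -> V) L :
  \sum_(1 <= k < M L) g k = \sum_(l < L) \sum_(M l <= k < M l.+1) g k.
Proof.
elim: L => [|L IH]; first by rewrite M0 big_geq // big_ord0.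
rewrite big_ord_recr -IH /= -big_cat_nat ?M_gt0 //.
exact: M_mono.
Qed.

Lemma level_exists L k : (1 <= k < M L)%N ->
  exists2 l, (l < L)%N & (M l <= k < M l.+1)%N.
Proof.
elim: L => [|L IH]; first by rewrite M0; case: k => [|[]].
move=> /andP[k1 kL]; have [kM|Mk] := ltnP k (M L).
  by have [|l lL h] := IH; [rewrite k1 | exists l => //; exact: ltnW].
by exists L; rewrite ?Mk.
Qed.

Lemma summation_by_parts (F : nat -> C) N : F 0%N = 0 -> (0 < N)%N ->
  \sum_(1 <= k < N) (F k - F k.-1) / k%:R =
  F N.-1 / N%:R + \sum_(1 <= k < N) F k * (k%:R^-1 - k.+1%:R^-1).
Proof.
move=> F0; case: N => // N _; elim: N => [|N IH].
  by rewrite !big_geq // F0 mul0r addr0.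
rewrite big_nat_recr // IH [in RHS]big_nat_recr //=.
by ring.
Qed.

Lemma sum_inv_diff (k n : nat) : (0 < k <= n)%N ->
  \sum_(k <= i < n) (i%:R^-1 - i.+1%:R^-1) <= k%:R^-1 :> R.
Proof.
move=> /andP[k0 kn].
have -> : \sum_(k <= i < n) (i%:R^-1 - i.+1%:R^-1) = k%:R^-1 - n%:R^-1 :> R.
  rewrite (eq_bigr (fun i => - (i.+1%:R^-1 - i%:R^-1))) => [|i _]; last by rewrite opprB.
  by rewrite sumrN telescope_sumr // opprB.
by rewrite gerBl invr_ge0.
Qed.

Lemma inv_nat_diff_ge0 k : (0 < k)%N -> 0 <= k%:R^-1 - k.+1%:R^-1 :> R.
Proof.
by move=> k0; rewrite subr_ge0 lef_pV2 ?posrE ?ltr0n // ler_nat.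
Qed.

(** After Abel summation, the differences 1/k - 1/(k+1) telescope to at most 1 / M_l on level l, and
    the boundary term is at most phi_l / M_l for one level l; hence the factor 2. *)
Lemma norm_sum_by_levels (F : nat -> C) (phi : nat -> R) L N :
  F 0%N = 0 -> (forall l, 0 <= phi l) ->
  (forall l k, (l < L)%N -> (M l <= k < M l.+1)%N -> nrm (F k) <= phi l) ->
  (0 < N <= M L)%N ->
  nrm (\sum_(1 <= k < N) (F k - F k.-1) / k%:R) <=
  \sum_(l < L) 2 * phi l / (M l)%:R.
Proof.
move=> F0 phi0 hF /andP[N0 NM]; rewrite summation_by_parts //.
apply: le_trans (le_normcD _ _) _.
have -> : \sum_(l < L) 2 * phi l / (M l)%:R =
    \sum_(l < L) phi l / (M l)%:R + \sum_(l < L) phi l / (M l)%:R.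
  by rewrite -big_split; apply: eq_bigr => l _ /=; ring.
have t0 l : 0 <= phi l / (M l)%:R by rewrite divr_ge0.
apply: lerD.
  rewrite Normc.normcM Normc.normcV normc_nat.
  (* For N = 1 the boundary term is F 0 = 0; otherwise N - 1 >= 1 belongs to a level. *)
  case: N N0 NM => [//|[|N]] _ NM /=.
    by rewrite F0 Normc.normc0 mul0r sumr_ge0.
  have [//|l lL /andP[Ml lM]] := @level_exists L N.+1.
  rewrite (bigD1 (Ordinal lL)) //= -[leLHS]addr0 lerD ?sumr_ge0 //.
  rewrite ler_pM ?invr_ge0 ?normc_ge0 ?hF ?Ml //.
  by rewrite lef_pV2 ?posrE ?ltr0n ?M_gt0 // ler_nat (leq_trans Ml).
apply: le_trans (normc_sum _ _ _) _.
have g0 k : (0 < k)%N -> 0 <= nrm (F k) * (k%:R^-1 - k.+1%:R^-1).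
  by move=> k0; rewrite mulr_ge0 ?normc_ge0 // inv_nat_diff_ge0.
apply: (@le_trans _ _ (\sum_(1 <= k < M L) nrm (F k) * (k%:R^-1 - k.+1%:R^-1))).
  rewrite (big_cat_nat N0 NM) /= -[leLHS]addr0; apply: lerD; last first.
    rewrite big_nat_cond sumr_ge0 // => k /andP[/andP[Nk _] _].
    by apply: g0; exact: leq_trans Nk.
  rewrite big_nat_cond [leRHS]big_nat_cond; apply: ler_sum => k /andP[/andP[k0 _] _].
  rewrite Normc.normcM.
  have -> : (k%:R^-1 - k.+1%:R^-1 : C) = (k%:R^-1 - k.+1%:R^-1)%:C%C.
    by rewrite rmorphB /= !fmorphV !rmorph_nat.
  by rewrite /= expr0n addr0 sqrtr_sqr ger0_norm // inv_nat_diff_ge0.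
rewrite sum_levels; apply: ler_sum => l _.
apply: (@le_trans _ _ (\sum_(M l <= k < M l.+1) phi l * (k%:R^-1 - k.+1%:R^-1))).
  rewrite big_nat_cond [leRHS]big_nat_cond; apply: ler_sum => k /andP[kl _].
  rewrite ler_wpM2r ?hF // inv_nat_diff_ge0 //.
  by move/andP: kl => [+ _]; apply: leq_trans; exact: M_gt0.
rewrite -mulr_sumr ler_wpM2l // sum_inv_diff // M_gt0 //=.
exact: M_mono.
Qed.

Variable a : nat -> C.

Lemma riesz_sum_eq (x : G) N :
  \sum_(1 <= k < N) partial_sum a k x / k%:R =
  \sum_(1 <= k < N) ((\sum_(j < k) partial_sum a j.+1 x)
     - \sum_(j < k.-1) partial_sum a j.+1 x) / k%:R :> C.
Proof.
rewrite big_nat_cond [RHS]big_nat_cond; apply: eq_bigr => -[//|k] _ /=.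
by rewrite big_ord_recr /= addrAC subrr add0r.
Qed.

Lemma norm_riesz_sum L N (x : G) : (0 < N <= M L)%N ->
  nrm (\sum_(1 <= k < N) partial_sum a k x / k%:R) <=
  \sum_(l < L) 2 * fejer_majorant B a l.+1 x / (M l)%:R.
Proof.
move=> NL; rewrite riesz_sum_eq.
apply: (@norm_sum_by_levels (fun k => \sum_(j < k) partial_sum a j.+1 x)
  (fun l => fejer_majorant B a l.+1 x)) => //.
- by rewrite big_ord0.
- by move=> l; exact: fejer_majorant_ge0.
- by move=> l k lL /andP[_ kM]; exact: norm_sum_partial_sum.
Qed.

Definition level_envelope N (x : G) : R := envelope (level_norm a x) N.

Lemma envelope_mono (u : nat -> R) k n : (forall l, 0 <= u l) -> (k <= n)%N ->
  envelope u k <= envelope u n.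
Proof.
move=> u0 /subnK <-; elim: (n - k)%N => [//|d IH].
apply: le_trans IH _; have := envelope_jump_ge0 u0 (d.+1 + k).
by rewrite addSn /envelope_jump subr_ge0.
Qed.

(** Level l has at most B M_l indices, each contributing at most 1 / M_l. *)
Lemma sum_inv_levels L : \sum_(1 <= k < M L) k%:R^-1 <= \sum_(l < L) B%:R :> R.
Proof.
rewrite sum_levels; apply: ler_sum => l _.
apply: (@le_trans _ _ (\sum_(M l <= k < M l.+1) (M l)%:R^-1)).
  rewrite big_nat_cond [leRHS]big_nat_cond; apply: ler_sum => k /andP[/andP[Mk _] _].
  rewrite lef_pV2 ?posrE ?ltr0n ?ler_nat // ?M_gt0 //.
  by rewrite (leq_trans _ Mk) // M_gt0.
rewrite sumr_const_nat -[_ *+ (_ - _)]mulr_natl ler_pdivrMr //.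
rewrite -natrM ler_nat (leq_trans (leq_subr _ _)) // MS mulnC.
by rewrite leq_mul2r mB orbT.
Qed.

(** L counts the levels needed to reach n, while N is the level of the envelope. The first summand
    bounds T_n and T_(M_j), the second bounds f_j times a harmonic sum. *)
Definition riesz_majorant N L (x : G) : R :=
  \sum_(l < L) (2 * fejer_majorant B a l.+1 x / (M l)%:R + B%:R * level_envelope N x).

(* [partial_sum a (minn (M j) k)] is the [M_j]-th partial sum of [S_k]. *)
Lemma norm_riesz_sum_min N L n j (x : G) : (L <= N)%N -> (0 < n <= M L)%N ->
  nrm (\sum_(1 <= k < n) partial_sum a (minn (M j) k) x / k%:R) <=
  riesz_majorant N L x.
Proof.
move=> LN /andP[n0 nL]; rewrite /riesz_majorant big_split /= .
have E0 : 0 <= level_envelope N x by apply: envelope_ge0 => l; exact: level_norm_ge0.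
have S0 : 0 <= \sum_(l < L) B%:R * level_envelope N x.
  by apply: sumr_ge0 => l _; rewrite mulr_ge0.
(* If n <= M_j, truncation at M_j changes nothing; otherwise all the terms with k >= M_j equal f_j /
   k. *)
have [nj|jn] := leqP n (M j).
  rewrite -[leLHS]addr0; apply: lerD => //.
  rewrite (_ : \sum_(1 <= k < n) _ = \sum_(1 <= k < n) partial_sum a k x / k%:R).
    by apply: norm_riesz_sum; rewrite n0.
  rewrite big_nat_cond [RHS]big_nat_cond; apply: eq_bigr => k /andP[/andP[_ kn] _].
  by rewrite (minn_idPr _) // ltnW // (leq_trans kn).
rewrite (big_cat_nat (M_gt0 m_ge2 j) (ltnW jn)) /=.
apply: le_trans (le_normcD _ _) _; apply: lerD.
  rewrite (_ : \sum_(1 <= k < M j) _ = \sum_(1 <= k < M j) partial_sum a k x / k%:R).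
    by apply: norm_riesz_sum; rewrite M_gt0 // (leq_trans (ltnW jn)).
  rewrite big_nat_cond [RHS]big_nat_cond; apply: eq_bigr => k /andP[/andP[_ kj] _].
  by rewrite (minn_idPr _) // ltnW.
(* M_j < n <= M_L forces j <= L, so the envelope at level N dominates |f_j|. *)
have jN : (j <= N)%N.
  apply: leq_trans LN; rewrite leqNgt; apply/negP => Lj.
  by have := M_mono m_ge2 (ltnW Lj); rewrite leqNgt (leq_trans jn).
have fj : nrm (partial_sum a (M j) x) <= level_envelope N x.
  apply: le_trans (envelope_mono _ jN); last exact: level_norm_ge0.
  by apply: (envelope_ge (u := level_norm a x)) => l; exact: level_norm_ge0.
apply: le_trans (normc_sum _ _ _) _.
apply: (@le_trans _ _ (\sum_(1 <= k < M L) level_envelope N x * k%:R^-1)).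
  rewrite (big_cat_nat (M_gt0 m_ge2 j) (leq_trans (ltnW jn) nL)) /=.
  rewrite [X in _ + X](big_cat_nat (ltnW jn) nL) /= addrCA -[leLHS]addr0.
  apply: lerD; last first.
    by rewrite addr_ge0 // sumr_ge0 // => k _; rewrite mulr_ge0 ?invr_ge0.
  rewrite big_nat_cond [leRHS]big_nat_cond; apply: ler_sum => k /andP[/andP[jk _] _].
  by rewrite (minn_idPl jk) Normc.normcM Normc.normcV normc_nat ler_wpM2r ?invr_ge0.
rewrite -[leLHS]mulr_sumr [leRHS](_ : _ = level_envelope N x * \sum_(l < L) B%:R).
  by rewrite ler_wpM2l // sum_inv_levels.
by rewrite mulr_sumr; apply: eq_bigr => l _; rewrite mulrC.
Qed.

Lemma riesz_majorant_cyl N L : (L <= N)%N -> cyl N (riesz_majorant N L).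
Proof.
move=> LN x y xy; apply: eq_bigr => l _.
have lN : (l.+1 <= N)%N := leq_trans (ltn_ord l) LN.
have -> : level_envelope N x = level_envelope N y.
  by apply: envelope_ext => i iN; exact: (level_norm_cyl m_ge2 a iN).
have -> // : fejer_majorant B a l.+1 x = fejer_majorant B a l.+1 y.
by apply: fejer_majorant_cyl => k kl; apply: xy; exact: leq_trans lN.
Qed.

Lemma riesz_majorant_ge0 N L (x : G) : 0 <= riesz_majorant N L x.
Proof.
have E0 : 0 <= level_envelope N x by apply: envelope_ge0 => l; exact: level_norm_ge0.
apply: sumr_ge0 => l _; apply: addr_ge0; last exact: mulr_ge0.
by rewrite divr_ge0 // mulr_ge0 // fejer_majorant_ge0.
Qed.

End riesz_sums.

(** * Summation of the Riesz majorants over all levels *)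

Section weighted_riesz_sums.
Context (R : realType) (m : nat -> nat) (m_ge2 : forall k, (2 <= m k)%N).
Context (B : nat) (mB : forall k, (m k <= B)%N).
Context (p : R) (p0 : 0 < p) (p12 : p < 1 / 2).
Local Notation G := (vilenkin m).
Local Notation C := R[i].
Local Notation M := (M m).
Variable a : nat -> C.

Let p1 : p <= 1. Proof. by have h := p12; lra. Qed.
Let r0 : 0 < 1 - 2 * p. Proof. by have h := p12; lra. Qed.
Let MR_gt0 n : 0 < (M n)%:R :> R. Proof. by rewrite ltr0n M_gt0. Qed.
Let MR_neq0 n : (M n)%:R != 0 :> R. Proof. by rewrite gt_eqF. Qed.

Let env0 N (x : G) : 0 <= level_envelope a N x.
Proof. by apply: envelope_ge0 => l; exact: level_norm_ge0. Qed.

Lemma sum_jump_powR N :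
  \sum_(i < N.+1) avg N (fun x : G => jump a i x `^ p) <=
  envelope_const p * avg N (fun x : G => level_envelope a N x `^ p).
Proof.
rewrite -avg_sum -avgZ; apply: ler_avg => x.
by apply: sum_envelope_jump_powR => // l; exact: level_norm_ge0.
Qed.

(** At most B M_l indices lie on level l, each of weight at most M_l^(-(2 - 2 p)). *)
Lemma sum_level_weights l :
  \sum_(M l <= n < M l.+1) n%:R `^ (- (2 - 2 * p)) <=
  B%:R * (M l)%:R `^ (- (1 - 2 * p)) :> R.
Proof.
apply: (@le_trans _ _ (\sum_(M l <= n < M l.+1) (M l)%:R `^ (- (2 - 2 * p)))).
  rewrite big_nat_cond [leRHS]big_nat_cond; apply: ler_sum => n /andP[/andP[Mn _] _].
  have n0 : (0 < n)%N by rewrite (leq_trans _ Mn) // M_gt0.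
  have p2 : 0 < 2 - 2 * p by have h := p12; lra.
  rewrite !powRN lef_pV2 ?posrE ?powR_gt0 ?ltr0n ?M_gt0 //.
  by apply: ler_powR_l => //; rewrite ler_nat.
rewrite sumr_const_nat -[_ *+ (_ - _)]mulr_natl.
have -> : (M l)%:R `^ (- (1 - 2 * p)) = (M l)%:R * (M l)%:R `^ (- (2 - 2 * p)) :> R.
  rewrite -{2}[(M l)%:R]powRr1 // -powRD ?MR_neq0 ?implybT //.
  by congr (_ `^ _); ring.
rewrite mulrA ler_wpM2r ?powR_ge0 // -natrM ler_nat (leq_trans (leq_subr _ _)) //.
by rewrite MS mulnC leq_mul2r mB orbT.
Qed.

Definition riesz_const : R := B%:R * (geo (1 - 2 * p) *
  (2 `^ p * (sum_fejer_const B p * envelope_const p) + B%:R `^ p * geo (1 - 2 * p))).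

Lemma riesz_const_ge0 : 0 <= riesz_const.
Proof.
have h1 : 0 < 1 - p by have h := p12; lra.
rewrite mulr_ge0 // mulr_ge0 ?geo_ge0 // addr_ge0 // mulr_ge0 ?powR_ge0 ?geo_ge0 //.
rewrite mulr_ge0 ?invr_ge0 ?subr_ge0 ?(ltW (pow2N_lt1 p0)) //.
apply: mulr_ge0; first exact: fejer_const_ge0.
by rewrite mulr_ge0 ?powR_ge0 // mulr_ge0 // geo_ge0.
Qed.

(** Level l carries the weight M_l^(-(1 - 2 p)) and involves the summands k <= l of the majorant.
    Exchanging the sums puts M_k^(-(1 - 2 p)) on summand k. On the Fejer part this combines with
    M_k^(-p) into M_k^(p-1), the weight of [sum_fejer_majorant]; on the envelope part it is
    summable. *)
Lemma weighted_riesz_majorant N :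
  \sum_(l < N) \sum_(M l <= n < M l.+1)
     n%:R `^ (- (2 - 2 * p)) * avg N (fun x : G => riesz_majorant B a N l.+1 x `^ p)
  <= riesz_const * avg N (fun x : G => level_envelope a N x `^ p).
Proof.
set A := avg N _.
pose ph l := avg N (fun x : G => fejer_majorant B a l.+1 x `^ p).
pose z l := 2 `^ p * (M l)%:R `^ (- p) * ph l + B%:R `^ p * A.
have A0 : 0 <= A by apply: avg_ge0 => x; exact: powR_ge0.
have ph0 l : 0 <= ph l by apply: avg_ge0 => x; exact: powR_ge0.
have z0 l : 0 <= z l by rewrite addr_ge0 // !mulr_ge0 // powR_ge0.
have maj L : avg N (fun x : G => riesz_majorant B a N L x `^ p) <= \sum_(l < L) z l.
  apply: (@le_trans _ _ (avg N (fun x : G => \sum_(l < L)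
     (2 `^ p * (M l)%:R `^ (- p) * fejer_majorant B a l.+1 x `^ p +
      B%:R `^ p * level_envelope a N x `^ p)))).
    apply: ler_avg => x; apply: le_trans (powR_sum p0 p1 _ _) _ => [l|].
      rewrite addr_ge0 ?(mulr_ge0 _ (env0 _ _)) //.
      by rewrite divr_ge0 // mulr_ge0 // fejer_majorant_ge0.
    apply: ler_sum => l _; have f0 := fejer_majorant_ge0 B a l.+1 x.
    have h2 : 0 <= B%:R * level_envelope a N x := mulr_ge0 (ler0n _ _) (env0 _ _).
    have h3 : 0 <= 2 * fejer_majorant B a l.+1 x := mulr_ge0 (ler0n _ 2) f0.
    have h1 : 0 <= 2 * fejer_majorant B a l.+1 x / (M l)%:R by rewrite divr_ge0.
    apply: le_trans (powR_subadditive p0 p1 h1 h2) _.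
    have -> : (2 * fejer_majorant B a l.+1 x / (M l)%:R) `^ p =
        2 `^ p * (M l)%:R `^ (- p) * fejer_majorant B a l.+1 x `^ p.
      rewrite powRM ?invr_ge0 // powRM //.
      by rewrite -(powR_inv1 (ltW (MR_gt0 l))) -powRrM mulN1r mulrAC.
    by rewrite [in X in _ + X <= _]powRM ?env0.
  rewrite avg_sum; apply: ler_sum => l _.
  by rewrite avgD !avgZ.
have lev l : \sum_(M l <= n < M l.+1)
     n%:R `^ (- (2 - 2 * p)) * avg N (fun x : G => riesz_majorant B a N l.+1 x `^ p)
   <= B%:R * \sum_(k < l.+1) ((M l)%:R `^ (- (1 - 2 * p)) * z k).
  rewrite -mulr_suml -mulr_sumr mulrA; apply: ler_pM => //.
  - by apply: sumr_ge0 => n _; exact: powR_ge0.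
  - by apply: avg_ge0 => x; exact: powR_ge0.
  - exact: sum_level_weights.
apply: le_trans; first by apply: ler_sum => l _; exact: lev.
rewrite -mulr_sumr /riesz_const -[leRHS]mulrA ler_wpM2l //.
pose q : R := 2 `^ (- (1 - 2 * p)).
(* The weight of level l is traded for that of level k <= l at a gain q^(l-k), summable over l for
   each fixed k. *)
apply: (@le_trans _ _ (\sum_(l < N) \sum_(k < N)
   (if (k <= l)%N then q ^+ (l - k) else 0) * ((M k)%:R `^ (- (1 - 2 * p)) * z k))).
  apply: ler_sum => l _.
  rewrite (big_ord_widen N (fun k => (M l)%:R `^ (- (1 - 2 * p)) * z k)) // big_mkcond /=.
  apply: ler_sum => k _; rewrite ltnS; case: ifPn => [kl|_]; last by rewrite mul0r.
  by rewrite mulrA ler_wpM2r // M_powN_ratio.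
rewrite exchange_big /=.
apply: (@le_trans _ _ (\sum_(k < N) geo (1 - 2 * p) * ((M k)%:R `^ (- (1 - 2 * p)) * z k))).
  apply: ler_sum => k _; rewrite -mulr_suml ler_wpM2r ?mulr_ge0 ?powR_ge0 //.
  exact: sum_geo_tail.
rewrite -mulr_sumr -mulrA ler_wpM2l ?geo_ge0 //.
rewrite (eq_bigr (fun k : 'I_N => 2 `^ p * ((M k)%:R `^ (p - 1) * ph k) +
   B%:R `^ p * ((M k)%:R `^ (- (1 - 2 * p)) * A))); last first.
  move=> k _; rewrite /z.
  have -> : (M k)%:R `^ (p - 1) = (M k)%:R `^ (- (1 - 2 * p)) * (M k)%:R `^ (- p) :> R.
    by rewrite -powRD ?MR_neq0 ?implybT //; congr (_ `^ _); ring.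
  by ring.
rewrite big_split /= -!mulr_sumr [leRHS]mulrDl; apply: lerD.
  rewrite -mulrA ler_wpM2l ?powR_ge0 //.
  apply: le_trans (sum_fejer_majorant m_ge2 mB p0 p12 a N) _.
  rewrite -[leRHS]mulrA ler_wpM2l ?sum_jump_powR //.
  have h1 : 0 < 1 - p by have h := p12; lra.
  apply: mulr_ge0; first exact: fejer_const_ge0.
  by rewrite mulr_ge0 ?powR_ge0 // mulr_ge0 // geo_ge0.
rewrite -mulr_suml -mulrA ler_wpM2l ?powR_ge0 // ler_wpM2r //.
apply: le_trans (sum_geo N r0); apply: ler_sum => k _.
exact: M_powN_le.
Qed.

End weighted_riesz_sums.

(** * Integrals of cylinder functions *)

Section haar_measure.
Context (R : realType) (m : nat -> nat) (m_ge2 : forall k, (2 <= m k)%N).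
Context (mu : probability (vilenkin m) R) (mu_haar : haar mu).
Local Notation G := (vilenkin m).
Local Notation M := (M m).
Implicit Types (x y : G).

Let K k := discrete_topology 'Z_(m k).

Lemma open_coord k (P : set 'Z_(m k)) : open [set x : G | P (x k)].
Proof.
have h : continuous ((fun x : G => x k) : G -> K k).
  exact: (@proj_continuous nat K k).
exact: (iffLR (continuousP _) h P (discrete_open _)).
Qed.

Lemma cvg_vilenkin (F : set_system G) (x : G) : Filter F ->
  (forall k, F [set y : G | y k = x k]) -> F --> x.
Proof.
move=> FF h; apply/cvg_sup => k A /= [_ [[B Bop <-] Bfs sBfA]].
apply: filterS (h k) => y yx; apply: sBfA.
by rewrite /preimage /= yx.
Qed.

Lemma translation_continuous (a : G) : continuous ((fun x => a + x) : G -> G).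
Proof.
move=> x; apply: cvg_vilenkin => [|k]; first exact: (fmap_filter (fun x0 => a + x0) (nbhs_filter x)).
have := @open_coord k [set c | a k + c = a k + x k].
rewrite openE => /(_ x); apply.
by [].
Qed.

Lemma translation_measurable (a : G) :
  measurable_fun setT ((fun x => a + x) : G -> G).
Proof.
apply: (@measurability _ _ G G setT _ (@open G)) => //.
move=> _ [U oU <-]; rewrite setTI.
by apply: sub_sigma_algebra; exact: (iffLR (continuousP _) (@translation_continuous a) U oU).
Qed.

(** Around each of its points the preimage contains the whole coset I_n(x), which is a finite
    intersection of open coordinate conditions. *)
Lemma open_cyl (T : Type) n (g : G -> T) (A : set T) : cyl n g -> open (g @^-1` A).
Proof.
move=> cg; rewrite openE => x Ax.
have h k : open [set y : G | forall j, (j < k)%N -> y j = x j].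
  elim: k => [|k IH].
    rewrite (_ : [set _ | _] = setT); first exact: openT.
    by apply/seteqP; split => // y _ j; rewrite ltn0.
  rewrite (_ : [set _ | _] = [set y : G | forall j, (j < k)%N -> y j = x j] `&`
     [set y : G | y k = x k]).
    by apply: openI => //; exact: (@open_coord k [set c | c = x k]).
  apply/seteqP; split => y /= hy; first by split => [j jk|]; apply: hy => //; exact: leqW.
  by case: hy => h1 h2 j; rewrite ltnS leq_eqVlt => /orP[/eqP ->|/h1].
have := h n; rewrite openE => /(_ x (fun _ _ => erefl)).
apply: filterS => y yx; rewrite /preimage /= (cg y x) //.
Qed.

Lemma cyl_measurable n (g : G -> R) : cyl n g -> measurable_fun setT g.
Proof.
move=> cg _ A mA; rewrite setTI; apply: sub_sigma_algebra; exact: (open_cyl _ cg).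
Qed.

Lemma cyl_shift n (g : G -> R) k c : cyl n g -> cyl n (fun x => g (x + evec m k c)).
Proof. by move=> cg x y xy; apply: cg => j jn; rewrite !vaddE xy. Qed.

(** Changing x_n into y_n only permutes the summands, so the sum forgets coordinate n. *)
Lemma cyl_average (K' : fieldType) n (g : G -> K') : cyl n.+1 g ->
  cyl n (fun x => \sum_(c < m n) g (x + evec m n c)).
Proof.
move=> cg x y xy; rewrite -(sum_evec_shift m_ge2 g n x (nat_of_ord ((y - x) n))).
apply: eq_bigr => c _; apply: cg => j; rewrite ltnS leq_eqVlt !vaddE => /orP[/eqP ->|jn].
  by rewrite !evec_in natr_Zp voppE; ring.
by rewrite !evec_out ?neq_ltn ?jn // !addr0 xy.
Qed.

(** |g| is the term c = 0 of a nonnegative sum over the last coordinate, and that sum depends on one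
    coordinate fewer. *)
Lemma cyl_bounded n (g : G -> R) : cyl n g -> exists b, forall x, `|g x| <= b.
Proof.
elim: n g => [|n IH] g cg.
  by exists `|g 0| => x; rewrite (cg x 0).
have cg' : cyl n.+1 (fun x => `|g x|) by move=> x y xy; rewrite (cg _ _ xy).
have [b hb] := IH _ (cyl_average cg'); exists b => x; apply: le_trans (hb x).
rewrite [leRHS]ger0_norm ?sumr_ge0 //.
have m0 : (0 < m n)%N by rewrite (leq_trans _ (m_ge2 n)).
by rewrite (bigD1 (Ordinal m0)) //= evec0 addr0 lerDl sumr_ge0.
Qed.

Lemma cyl_integrable n (g : G -> R) : cyl n g -> mu.-integrable setT (EFin \o g).
Proof.
move=> cg; apply: measurable_bounded_integrable => //.
- by rewrite -ge0_fin_numE // fin_num_measure.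
- exact: cyl_measurable cg.
- have [b hb] := cyl_bounded cg; exists b; split; first exact: num_real.
  by move=> t bt x _; apply: le_trans (hb x) (ltW bt).
Qed.

Lemma integral_translate n (g : G -> R) a : cyl n g ->
  (\int[mu]_x (g (a + x))%:E = \int[mu]_x (g x)%:E)%E.
Proof.
move=> cg.
have ma := @translation_measurable a.
have /integrableP[mg _] := cyl_integrable cg.
have cga : cyl n (fun x => g (a + x)) by move=> x y xy; apply: cg => j jn; rewrite !vaddE xy.
have ig : mu.-integrable ((fun x => a + x) @^-1` setT) ((fun x => (g (a + x))%:E) : G -> \bar R).
  exact: cyl_integrable cga.
transitivity (\int[pushforward mu (fun x => (a + x)%R)]_y (g y)%:E)%E.
  by have := integral_pushforward ma mg ig measurableT => ->.
apply: eq_measure_integral => A mA _.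
(* The preimage of A under x -> a + x is the translate of A by -a, so the push-forward of [mu] is
   [mu]. *)
rewrite /pushforward; transitivity (mu [set - a + x | x in A]); last exact: mu_haar.
congr (mu _).
apply/seteqP; split => [x /= ax|x /= [y Ay <-]]; last by rewrite addNKr.
by exists (a + x) => //; rewrite addKr.
Qed.

(** By translation invariance, averaging over the last coordinate keeps the integral; after n steps
    g is constant and [mu] has mass 1. *)
Lemma integral_avg n (g : G -> R) : cyl n g -> (\int[mu]_x (g x)%:E = (avg n g)%:E)%E.
Proof.
elim: n g => [|n IH] g cg.
  rewrite (eq_integral (cst (g 0)%:E)) => [|x _]; last by rewrite /= (cg x 0).
  rewrite integral_cst //; have /= -> := @probability_setT _ _ _ mu.
  by rewrite mule1.
rewrite /= -IH; last first.
  by move=> x y xy; rewrite (cyl_average cg xy).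
under [RHS]eq_integral => x _ do rewrite EFinM -sumEFin.
have ci c : mu.-integrable setT (fun x => (g (x + evec m n c))%:E).
  exact: (cyl_integrable (cyl_shift n c cg)).
rewrite integralZl //; last exact: integrable_sum.
rewrite integral_sum //.
under eq_bigr => c _.
  under eq_integral do rewrite addrC.
  rewrite (integral_translate _ cg).
  over.
have [r ->] : exists r, (\int[mu]_x (g x)%:E)%E = r%:E.
  by eexists; rewrite -[LHS]fineK // integrable_fin_num //; exact: (cyl_integrable cg).
rewrite sumEFin sumr_const card_ord -[r *+ _]mulr_natl -EFinM mulKf //.
by rewrite pnatr_eq0 -lt0n (leq_trans _ (m_ge2 _)).
Qed.

End haar_measure.

(** * Fourier coefficients *)

Section fourier_coefficients.
Context (R : realType) (m : nat -> nat) (m_ge2 : forall k, (2 <= m k)%N).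
Context (mu : probability (vilenkin m) R) (mu_haar : haar mu).
Local Notation G := (vilenkin m).
Local Notation C := R[i].
Local Notation M := (M m).
Local Notation nrm := (@Normc.normc R).
Implicit Types (x : G) (a : nat -> C).

Lemma Re_real_mul (r : R) (z : C) : complex.Re (r%:C%C * z) = r * complex.Re z.
Proof. by case: z => u v /=; rewrite mul0r subr0. Qed.

Lemma Im_real_mul (r : R) (z : C) : complex.Im (r%:C%C * z) = r * complex.Im z.
Proof. by case: z => u v /=; rewrite mul0r addr0. Qed.

Lemma Re_sum n (F : 'I_n -> C) :
  complex.Re (\sum_i F i) = \sum_i complex.Re (F i).
Proof.
have add (z w : C) : complex.Re (z + w) = complex.Re z + complex.Re w by case: z w => ? ? [].
by elim/big_ind2: _ => // u1 r1 u2 r2 <- <-.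
Qed.

Lemma Im_sum n (F : 'I_n -> C) :
  complex.Im (\sum_i F i) = \sum_i complex.Im (F i).
Proof.
have add (z w : C) : complex.Im (z + w) = complex.Im z + complex.Im w by case: z w => ? ? [].
by elim/big_ind2: _ => // u1 r1 u2 r2 <- <-.
Qed.

Lemma natC_inv k : (k%:R : C)^-1 = (k%:R^-1)%:C%C.
Proof. by rewrite fmorphV /= rmorph_nat. Qed.

Lemma Re_avg n (g : G -> C) : complex.Re (avg n g) = avg n (fun x => complex.Re (g x)).
Proof.
elim: n g => [//|n IH] g /=; rewrite IH; apply: eq_avg => x.
by rewrite natC_inv Re_real_mul Re_sum.
Qed.

Lemma Im_avg n (g : G -> C) : complex.Im (avg n g) = avg n (fun x => complex.Im (g x)).
Proof.
elim: n g => [//|n IH] g /=; rewrite IH; apply: eq_avg => x.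
by rewrite natC_inv Im_real_mul Im_sum.
Qed.

Lemma cintegral_avg n (g : G -> C) : cyl n g -> cintegral mu g = avg n g.
Proof.
move=> cg; rewrite /cintegral /Rintegral.
rewrite !(@integral_avg _ _ m_ge2 mu mu_haar n) /=; last 2 first.
- by move=> x y xy; rewrite (cg _ _ xy).
- by move=> x y xy; rewrite (cg _ _ xy).
by rewrite -Re_avg -Im_avg; case: (avg n g).
Qed.

Lemma fourier_coef_avg n i (g : G -> C) : cyl n g -> (i < M n)%N ->
  fourier_coef mu g i = avg n (fun x => g x * ((psi R i x)^*)%C).
Proof.
move=> cg iM; apply: cintegral_avg => x y xy.
by rewrite (cg _ _ xy) (psi_cyl R m_ge2 iM xy).
Qed.

Lemma fourier_coef_partial_sum a n i :
  fourier_coef mu (partial_sum a n) i = if (i < n)%N then a i else 0.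
Proof.
pose L := maxn n i.
have nL : (n <= M L)%N by rewrite (leq_trans (leq_maxl n i)) // ltnW // ltn_M.
have iL : (i < M L)%N by rewrite (leq_ltn_trans (leq_maxr n i)) // ltn_M.
rewrite (fourier_coef_avg (partial_sum_cyl m_ge2 a nL) iL).
rewrite (@eq_avg _ _ _ _ (fun x => \sum_(k < n) a k * (psi R k x * ((psi R i x)^*)%C))); last first.
  by move=> x; rewrite /partial_sum mulr_suml; apply: eq_bigr => k _; rewrite mulrA.
rewrite avg_sum (eq_bigr (fun k : 'I_n => a k * (k == i :> nat)%:R)); last first.
  by move=> k _; rewrite avgZ avg_psi // (leq_trans (ltn_ord k)).
case: ifPn => iN; last first.
  rewrite big1 // => k _; case: eqP => [ki|]; last by rewrite mulr0.
  by move: iN; rewrite -ki ltn_ord.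
rewrite (bigD1 (Ordinal iN)) //= eqxx mulr1 big1 ?addr0 // => k ki.
rewrite (_ : (k == i :> nat) = false) ?mulr0 //.
by apply/negbTE; apply: contra ki => /eqP e; apply/eqP/val_inj.
Qed.

Lemma fourier_coef_riesz a n i :
  fourier_coef mu (riesz_log_mean a n) i =
  (\sum_(1 <= k < n) (k%:R)^-1)^-1 *
  \sum_(1 <= k < n) (if (i < k)%N then a i else 0) / k%:R.
Proof.
pose L := maxn n i.
have nL : (n <= M L)%N by rewrite (leq_trans (leq_maxl n i)) // ltnW // ltn_M.
have iL : (i < M L)%N by rewrite (leq_ltn_trans (leq_maxr n i)) // ltn_M.
have ck k : (k < n)%N -> cyl L (@partial_sum R m a k).
  by move=> kn; apply: partial_sum_cyl => //; rewrite (leq_trans (ltnW kn)).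
have cR : cyl L (@riesz_log_mean R m a n).
  move=> x y xy; rewrite /riesz_log_mean.
  suff -> : \sum_(1 <= k < n) partial_sum a k x / k%:R =
    \sum_(1 <= k < n) partial_sum a k y / k%:R by [].
  by apply: eq_big_nat => k /andP[_ kn]; rewrite (ck k kn _ _ xy).
rewrite (fourier_coef_avg cR iL).
rewrite (@eq_avg _ _ _ _ (fun x => (\sum_(1 <= k < n) (k%:R)^-1)^-1 *
   \sum_(1 <= k < n) k%:R^-1 * (partial_sum a k x * ((psi R i x)^*)%C))); last first.
  move=> x; rewrite /riesz_log_mean -mulrA mulr_suml; congr (_ * _).
  by apply: eq_bigr => k _; rewrite mulrAC mulrC.
rewrite avgZ avg_sum; congr (_ * _).
rewrite big_nat_cond [RHS]big_nat_cond; apply: eq_bigr => k /andP[/andP[_ kn] _].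
by rewrite avgZ -(fourier_coef_avg (ck k kn) iL) fourier_coef_partial_sum mulrC.
Qed.

(** The N-th partial sum acts on each S_k by truncating it at min(N, k), as the coefficients of S_k
    are those of the series below k and 0 beyond. *)
Lemma S_riesz a n N x :
  S_ mu N (riesz_log_mean a n) x =
  (\sum_(1 <= k < n) (k%:R)^-1)^-1 *
  \sum_(1 <= k < n) partial_sum a (minn N k) x / k%:R.
Proof.
rewrite /S_ {1}/partial_sum.
under eq_bigr do rewrite fourier_coef_riesz -mulrA mulr_suml.
rewrite -mulr_sumr exchange_big /=; congr (_ * _); apply: eq_bigr => k _.
rewrite /partial_sum mulr_suml.
rewrite (big_ord_widen N (fun i => a i * psi R i x / k%:R)) ?geq_minl // [RHS]big_mkcond /=.
apply: eq_bigr => i _; rewrite leq_min ltn_ord /=.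
by case: ifP => _; rewrite ?mul0r // mulrAC.
Qed.

(** By the martingale identity the i-th coefficient of f_l is the same for all l with i < M_l, so
    the limit is attained and one coefficient sequence encodes the whole martingale. *)
Lemma mfourier_coef_martingale (f : nat -> G -> C) n : martingale mu f ->
  f n = partial_sum (mfourier_coef mu f) (M n).
Proof.
move=> [_ _ fS].
have coef k l i : (k <= l)%N -> (i < M k)%N ->
    fourier_coef mu (f l) i = fourier_coef mu (f k) i.
  by move=> kl iM; rewrite -(fS k l kl) /S_ fourier_coef_partial_sum iM.
rewrite -{1}(fS n n (leqnn n)); apply/funext => x; rewrite /S_ /partial_sum; apply: eq_bigr => i _.
congr (_ * _); apply/esym; rewrite /mfourier_coef.
apply: (@lim_near_cst (R[i] : numFieldType)); first exact: norm_hausdorff.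
by exists n => // l /= nl; exact: coef.
Qed.

End fourier_coefficients.

(** * Hardy norms *)

Section hardy_norms.
Context (R : realType) (m : nat -> nat) (m_ge2 : forall k, (2 <= m k)%N).
Context (mu : probability (vilenkin m) R) (mu_haar : haar mu).
Context (p : R) (p0 : 0 < p).
Local Notation G := (vilenkin m).
Local Notation C := R[i].
Local Notation M := (M m).
Local Notation nrm := (@Normc.normc R).

Lemma maximal_ge0 (f : nat -> G -> C) x : (0 <= maximal f x)%E.
Proof.
apply: le_trans (ereal_sup_ubound _ : ((nrm (f 0%N x))%:E <= _)%E).
  by rewrite lee_fin normc_ge0.
by exists 0%N.
Qed.

Lemma Hnorm_powR (f : nat -> G -> C) :
  (Hnorm mu p f `^ p = \int[mu]_x (maximal f x `^ p))%E.
Proof.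
rewrite /Hnorm Lnorm.unlock -poweRrM mulVf ?gt_eqF // poweRe1; last first.
  by apply: integral_ge0 => x _; exact: poweR_ge0.
by apply: eq_integral => x _; rewrite gee0_abs // maximal_ge0.
Qed.

Lemma maximal_measurable (f : nat -> G -> C) :
  (forall n, exists L, cyl L (f n)) ->
  measurable_fun setT (fun x => (maximal f x `^ p)%E).
Proof.
move=> cf; apply: (measurableT_comp (measurable_poweR p)).
have h n : measurable_fun setT (fun x : G => (nrm (f n x))%:E).
  have [L cL] := cf n; apply/measurable_EFinP.
  by apply: (@cyl_measurable _ _ L) => x y xy; rewrite (cL _ _ xy).
have := measurable_fun_esups h 0%N; congr (measurable_fun _ _).
apply/funext => x; rewrite /esups /sdrop /maximal /=; congr ereal_sup.
by apply/seteqP; split => _ [n _ <-]; exists n.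
Qed.

Lemma Hnorm_le_avg (f : nat -> G -> C) N (V : G -> R) :
  (forall n, exists L, cyl L (f n)) -> cyl N V ->
  (forall n x, nrm (f n x) <= V x) ->
  (Hnorm mu p f `^ p <= (avg N (fun x => V x `^ p))%:E)%E.
Proof.
move=> cf cV fV; rewrite Hnorm_powR.
have V0 x : 0 <= V x := le_trans (normc_ge0 _) (fV 0%N x).
have cVp : cyl N (fun x => V x `^ p) by move=> x y xy; rewrite (cV _ _ xy).
rewrite -(integral_avg m_ge2 mu_haar cVp).
apply: ge0_le_integral => //.
- by move=> x _; exact: poweR_ge0.
- exact: maximal_measurable.
- by apply/measurable_EFinP; exact: cyl_measurable cVp.
move=> x _; rewrite -poweR_EFin; apply: gt0_ler_poweR; first exact: ltW.
- by rewrite in_itv /= maximal_ge0 leey.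
- by rewrite in_itv /= lee_fin V0 leey.
by apply: ge_ereal_sup => _ [n _ <-]; rewrite lee_fin.
Qed.

(** The envelope is always twice some |f_i|, hence at most twice the maximal function. *)
Lemma envelope_le_Hnorm (a : nat -> C) (f : nat -> G -> C) N :
  (forall n, f n = partial_sum a (M n)) ->
  ((avg N (fun x : vilenkin m => level_envelope a N x `^ p))%:E <=
   (2 `^ p)%:E * Hnorm mu p f `^ p)%E.
Proof.
move=> fE; rewrite Hnorm_powR.
have cf n : exists L, cyl L (f n) by exists n; rewrite fE; exact: partial_sum_cyl.
have cE : cyl N (fun x : vilenkin m => level_envelope a N x `^ p).
  move=> x y xy; suff -> : level_envelope a N x = level_envelope a N y by [].
  by apply: envelope_ext => i iN; exact: (level_norm_cyl m_ge2 a iN).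
have mM := maximal_measurable cf.
rewrite -(integral_avg m_ge2 mu_haar cE) -ge0_integralZl_EFin ?powR_ge0 //; last first.
  by move=> x _; exact: poweR_ge0.
apply: ge0_le_integral => //.
- by move=> x _; rewrite lee_fin powR_ge0.
- by apply/measurable_EFinP; exact: cyl_measurable cE.
- exact: measurable_funeM.
move=> x _; have [i iN e] := envelope_le (level_norm a x) N.
rewrite /level_envelope e powRM ?level_norm_ge0 // EFinM.
apply: lee_wpmul2l; first by rewrite lee_fin powR_ge0.
rewrite -poweR_EFin; apply: gt0_ler_poweR; first exact: ltW.
- by rewrite in_itv /= lee_fin level_norm_ge0 leey.
- by rewrite in_itv /= maximal_ge0 leey.
by apply: ereal_sup_ubound; exists i => //; rewrite fE.
Qed.

(** Each step adds ln (1 + 1/n) <= 1/n. *)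
Lemma ln_le_harmonic n : (1 <= n)%N -> ln n%:R <= \sum_(1 <= k < n) k%:R^-1 :> R.
Proof.
case: n => // n _; elim: n => [|n IH]; first by rewrite big_geq // ln1.
rewrite big_nat_recr //=; apply: le_trans (lerD IH (lexx _)).
have n0 : 0 < n.+1%:R :> R by [].
have -> : n.+2%:R = n.+1%:R * (1 + n.+1%:R^-1) :> R.
  by rewrite mulrDr mulr1 mulfV ?gt_eqF // -natr1.
have i0 : 0 < n.+1%:R^-1 :> R by rewrite invr_gt0.
rewrite lnM ?posrE ?addr_gt0 //.
by rewrite lerD2l le_ln1Dx // (lt_trans _ i0) // ltrN10.
Qed.

Lemma harmonic_gt0 n : (2 <= n)%N -> 0 < \sum_(1 <= k < n) k%:R^-1 :> R.
Proof.
move=> n2; rewrite big_ltn // invr1 ltr_wpDr //.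
by apply: sumr_ge0 => k _; rewrite invr_ge0.
Qed.

End hardy_norms.

(** * The weighted series of Hardy norms of the Riesz means *)

Theorem mainTheorem15 (R : realType) (m : nat -> nat)
    (mu : probability (vilenkin m) R) (p : R)
    (m_ge2 : forall k, (2 <= m k)%N)
    (m_bounded : exists B : nat, forall k, (m k <= B)%N)
    (mu_haar : haar mu)
    (p_gt0 : 0 < p) (p_lt : p < 1 / 2) :
  exists c : R, forall f : nat -> vilenkin m -> R[i],
    Hardy mu p f ->
    (\sum_(2 <= n <oo)
       ((ln n%:R `^ p / n%:R `^ (2 - 2 * p))%R%:E *
        Hnorm mu p (martingale_of mu (mriesz mu n f)) `^ p)
     <= c%:E * Hnorm mu p f `^ p)%E.
Proof.
(* [riesz_const] comes from the sum over levels, 2^p from comparing the envelope with the maximal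
   function. *)
have [B mB] := m_bounded; exists (riesz_const B p * 2 `^ p) => f [fm _].
set a := mfourier_coef mu f.
have fE n : f n = partial_sum a (M m n) := mfourier_coef_martingale m_ge2 mu_haar n fm.
pose t n := ((ln n%:R `^ p / n%:R `^ (2 - 2 * p))%R%:E *
        Hnorm mu p (martingale_of mu (mriesz mu n f)) `^ p)%E.
have w0 n : 0 <= ln n%:R `^ p / n%:R `^ (2 - 2 * p) :> R.
  by rewrite divr_ge0 // powR_ge0.
have t0 n : (0 <= t n)%E by rewrite mule_ge0 ?poweR_ge0 // lee_fin.
(* One envelope level N serves all n <= M_N, while L follows the level of n, as
   [weighted_riesz_majorant] requires. *)
have term N L n : (2 <= n <= M m L)%N -> (L <= N)%N ->
    (t n <= (n%:R `^ (- (2 - 2 * p)) *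
      avg N (fun x : vilenkin m => riesz_majorant B a N L x `^ p))%:E)%E.
  move=> /andP[n2 nL] LN.
  have l0 := harmonic_gt0 R n2; set l := \sum_(1 <= k < n) _ in l0.
  have gE j x : martingale_of mu (mriesz mu n f) j x = (l^-1)%:C%C *
      \sum_(1 <= k < n) partial_sum a (minn (M m j) k) x / k%:R.
    rewrite /martingale_of /mriesz S_riesz // -/a; congr (_ * _).
    rewrite fmorphV /l rmorph_sum /=; congr (_^-1).
    by apply: eq_bigr => k _; rewrite fmorphV /= rmorph_nat.
  have cg j : exists L, cyl L (martingale_of mu (mriesz mu n f) j).
    exists j => x y xy; rewrite !gE.
    suff -> : \sum_(1 <= k < n) partial_sum a (minn (M m j) k) x / k%:R =
      \sum_(1 <= k < n) partial_sum a (minn (M m j) k) y / k%:R by [].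
    by apply: eq_bigr => k _; rewrite (partial_sum_cyl m_ge2 a (geq_minl _ _) xy).
  have maj j x : Normc.normc (martingale_of mu (mriesz mu n f) j x) <=
      l^-1 * riesz_majorant B a N L x.
    rewrite gE Normc.normcM; apply: ler_pM; rewrite ?normc_ge0 //.
      by rewrite /= expr0n addr0 sqrtr_sqr ger0_norm // invr_ge0 ltW.
    by apply: norm_riesz_sum_min => //; rewrite (leq_trans _ n2).
  have cV : cyl N (fun x : vilenkin m => l^-1 * riesz_majorant B a N L x).
    by move=> x y xy; rewrite (riesz_majorant_cyl m_ge2 B a LN xy).
  have := Hnorm_le_avg m_ge2 mu_haar p_gt0 cg cV maj.
  have V0 x := riesz_majorant_ge0 B a N L x.
  rewrite (@eq_avg _ _ _ _ (fun x : vilenkin m => l^-1 `^ p * riesz_majorant B a N L x `^ p)); last first.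
    by move=> x; rewrite powRM // invr_ge0 ltW.
  rewrite avgZ; set A := avg N _ => h.
  have A0 : 0 <= A by apply: avg_ge0 => x; exact: powR_ge0.
  apply: (@le_trans _ _ ((ln n%:R `^ p / n%:R `^ (2 - 2 * p))%:E * (l^-1 `^ p * A)%:E)%E).
    by apply: lee_wpmul2l => //; rewrite lee_fin.
  rewrite -EFinM lee_fin mulrA ler_wpM2r //.
  rewrite mulrAC powRN -[leRHS]mul1r ler_wpM2r ?invr_ge0 ?powR_ge0 //.
  (* What remains is (ln n)^p (1/l)^p <= 1, which follows from ln n <= l: the logarithmic weight is
     cancelled by the normalisation of the Riesz mean. *)
  have ln0 : 0 <= ln n%:R :> R by rewrite ln_ge0 // ler1n (leq_trans _ n2).
  have e1 : 1 = 1 `^ p :> R by rewrite powR1.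
  rewrite [leRHS]e1 {e1}.
  rewrite -powRM ?invr_ge0 ?(ltW l0) //; apply: ler_powR_l => //.
    by rewrite mulr_ge0 // invr_ge0 ltW.
  by rewrite ler_pdivrMr // mul1r ln_le_harmonic // (leq_trans _ n2).
pose A N := avg N (fun x : vilenkin m => level_envelope a N x `^ p).
have fin N : (\sum_(2 <= n < M m N) t n <= (riesz_const B p * A N)%:E)%E.
  have := weighted_riesz_majorant m_ge2 mB p_gt0 p_lt a N.
  rewrite -lee_fin; apply: le_trans.
  pose u l n := n%:R `^ (- (2 - 2 * p)) *
    avg N (fun x : vilenkin m => riesz_majorant B a N l.+1 x `^ p).
  (* The decomposition into levels starts at n = 1, so the series is extended by a zero term
     there. *)
  pose t' n := if (2 <= n)%N then t n else 0%E.
  have -> : (\sum_(2 <= n < M m N) t n = \sum_(1 <= n < M m N) t' n)%E.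
    have [K1|K1] := leqP (M m N) 1.
      by rewrite !big_geq // (leq_trans K1).
    rewrite [RHS]big_ltn // add0e; apply: eq_big_nat => n /andP[n2 _].
    by rewrite /t' n2.
  rewrite sum_levels // -sumEFin; apply: lee_sum => l _; rewrite -sumEFin.
  rewrite big_nat_cond [leRHS]big_nat_cond; apply: lee_sum => n /andP[/andP[ln nl] _].
  rewrite /t'; case: ifPn => n2; last first.
    by rewrite lee_fin mulr_ge0 ?powR_ge0 // avg_ge0 // => x; exact: powR_ge0.
  by apply: term => //; rewrite n2 ltnW.
apply: lime_le; first by apply: is_cvg_nneseries => n _ _; exact: t0.
(* Since N < M_N, the partial sum up to N is at most the one up to M_N, to which the level estimate
   applies. *)
apply: nearW => N; apply: (@le_trans _ _ (\sum_(2 <= n < M m N) t n)%E).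
  have [N2|N2] := leqP N 2; first by rewrite big_geq // sume_ge0.
  rewrite [leRHS](big_cat_nat (ltnW N2) (ltnW (ltn_M m_ge2 N))) /=.
  by rewrite leeDl // sume_ge0.
apply: le_trans (fin N) _; rewrite (EFinM (riesz_const B p)) (EFinM (riesz_const B p)) -muleA.
apply: lee_wpmul2l; last exact: envelope_le_Hnorm.
by rewrite lee_fin riesz_const_ge0.
Qed.
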